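(* Let $\mu$ be a measure on $M_k$ and let $L:M_k\to M_k$ be measurable with $\int_{M_k}\|L(v)\|^2d\mu(v)<\infty$ and $\phi_L$ stochastic. If a Borel probability $\nu$ on $P(\mathbb{C}^k)$ is invariant for $\Pi_L$, then $$\rho_\nu=\mathbb{E}_\nu(\pi_{\hat X_0})=\mathbb{E}_\nu(\pi_{\hat X_1})=\phi_L(\rho_\nu).$$ Therefore, if moreover $L$ is irreducible for $\mu$, every invariant probability $\nu$ for $\Pi_L$ has the same barycenter $\rho_\nu$.
   Context: $M_k$ is the set of complex $k\times k$ matrices with its Borel $\sigma$-algebra, $\dagger$ is the conjugate transpose; on $M_k$, $\|A\|=\sqrt{\operatorname{tr}(AA^\dagger)}$. For measurable $L:M_k\to M_k$ with $\int\|L(v)\|^2d\mu(v)<\infty$ put $\phi_L(\rho)=\int_{M_k}L(v)\rho L(v)^\dagger d\mu(v)$ on $M_k$. $L$ is irreducible for $\mu$ if the only Hermitian projectors $P\in M_k$ with $\phi_L(PM_kP)\subset PM_kP$ are $P=0$ and $P=\mathrm{Id}$; $\phi_L$ is stochastic if $\int_{M_k}L(v)^\dagger L(v)\,d\mu(v)=\mathrm{Id}$. $P(\mathbb{C}^k)$ is the projective space of $\mathbb{C}^k$ with metric $d(\hat x,\hat y)=(1-|\langle x,y\rangle|^2)^{1/2}$ ($x,y$ unit representatives). For $A\in M_k$ with $Ax\ne0$, $A\cdot\hat x$ is the class of $Ax$. $\pi_{\hat x}=|x\rangle\langle x|$ is the orthogonal projection onto the line $\hat x$. For a Borel probability $\nu$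 on $P(\mathbb{C}^k)$ and Borel $S$, $$\nu\Pi_L(S)=\int_{P(\mathbb{C}^k)\times M_k}\mathbf 1_S(L(v)\cdot\hat x)\|L(v)x\|^2\,d\nu(\hat x)d\mu(v)$$ (Euclidean norm on $\mathbb{C}^k$; the integrand is $0$ when $L(v)x=0$); $\nu$ is invariant for $\Pi_L$ if $\nu\Pi_L=\nu$. Let $\Omega=M_k^{\mathbb{N}}$, $\omega=(\omega_1,\omega_2,\dots)$, and $W_n(\omega)=L(\omega_n)\cdots L(\omega_1)$. $\mathbb{P}_\nu$ is the probability on $P(\mathbb{C}^k)\times\Omega$ determined by $$\mathbb{P}_\nu(S\times O_n)=\int_{S\times O_n}\|W_n(\omega)x\|^2\,d\nu(\hat x)\,d\mu^{\otimes n}(\omega)$$ for $S\subset P(\mathbb{C}^k)$ Borel and $O_n$ in the $\sigma$-algebra generated by the first $n$ coordinates; $\mathbb{E}_\nu$ is its expectation. $\hat X_0(\hat x,\omega)=\hat x$ and $\hat X_n(\hat x,\omega)=W_n(\omega)\cdot\hat x$ (defined $\mathbb{P}_\nu$-a.s.). The barycenter of $\nu$ is $\rho_\nu=\int_{P(\mathbb{C}^k)}\pi_{\hat x}\,d\nu(\hat x)$. *)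

(* Defs.v *)
From HB Require Import structures.
From mathcomp Require Import all_boot all_order all_algebra spectral.
From mathcomp Require Import complex.
From mathcomp Require Import all_classical all_reals all_analysis.

Set Implicit Arguments.
Unset Strict Implicit.
Unset Printing Implicit Defensive.

Import Order.TTheory GRing.Theory Num.Theory.
Import numFieldTopology.Exports numFieldNormedType.Exports.

Local Open Scope classical_set_scope.
Local Open Scope sesquilinear_scope.
Local Open Scope complex_scope.
Local Open Scope ring_scope.

(* The matrix size is k.+1 throughout: a measurableType is pointed, and the
   projective space of C^0 is empty, so it carries no probability. *)

(* A ^t* is the conjugate transpose. For a column vector x, tr(x x^t* ) is the
   sum of the |x_i|^2, so that hsnorm is also the Euclidean norm on C^m. *)
Definition hsnorm (R : realType) (m n : nat) (A : 'M[R[i]]_(m, n)) : R :=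
  Num.sqrt (complex.Re (\tr (A *m A ^t*))).

(* The order of R[i] makes `|z| an element of R[i] with imaginary part 0. *)
Definition cabs (R : realType) (z : R[i]) : R := complex.Re `|z|.

Definition inner (R : realType) (n : nat) (x y : 'cV[R[i]]_n) : R[i] :=
  (x ^t* *m y) 0 0.

(* Bochner integral of a complex (resp. matrix) valued function: componentwise,
   hence meaningful when the components are integrable. *)
Definition cintegral (R : realType) d (T : measurableType d)
    (m : {measure set T -> \bar R}) (f : T -> R[i]) : R[i] :=
  (\int[m]_t complex.Re (f t)) +i* (\int[m]_t complex.Im (f t)).

Definition mxintegral (R : realType) d (T : measurableType d) (n : nat)
    (m : {measure set T -> \bar R}) (F : T -> 'M[R[i]]_n) : 'M[R[i]]_n :=
  \matrix_(i, j) cintegral m (fun t => F t i j).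

(* R[i]^o selects the topology of the modulus on R[i]. *)
Definition borelM (R : realType) (k : nat) :=
  g_sigma_algebraType (@open 'M[(R[i])^o]_k.+1).

Section projective_space.
Variables (R : realType) (k : nat).

Record projective := Projective {
  line :> {vspace 'cV[R[i]]_k.+1} ;
  _ : \dim line == 1%N }.

HB.instance Definition _ := [isSub for line].
HB.instance Definition _ := [Choice of projective by <:].

Lemma projective_point_subproof :
  \dim <[const_mx 1 : 'cV[R[i]]_k.+1]>%VS == 1%N.
Proof.
rewrite dim_vline eqb1; apply/eqP => /matrixP /(_ 0 0) /eqP.
by rewrite !mxE oner_eq0.
Qed.

HB.instance Definition _ := isPointed.Build projective
  (Projective projective_point_subproof).

Definition unit_rep (x : projective) : 'cV[R[i]]_k.+1 :=
  ((hsnorm (vpick x))^-1)%:C *: vpick x.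

Definition pdist (x y : projective) : R :=
  Num.sqrt (1 - cabs (inner (unit_rep x) (unit_rep y)) ^+ 2).

Definition popen : set_system projective :=
  [set U | forall x, U x -> exists2 e : R, 0 < e & [set y | pdist x y < e] `<=` U].

(* Junk value x when A kills the line x. *)
Definition pact (A : 'M[R[i]]_k.+1) (x : projective) : projective :=
  insubd x <[A *m unit_rep x]>%VS.

Definition ppi (x : projective) : 'M[R[i]]_k.+1 :=
  unit_rep x *m (unit_rep x) ^t*.

End projective_space.

Definition borelP (R : realType) (k : nat) :=
  g_sigma_algebraType (@popen R k).

(* Coordinates are numbered from 0: w i is omega_{i+1}. *)
Definition coord_sets (R : realType) (k : nat) (i : nat) :
    set_system (nat -> borelM R k) :=
  preimage_set_system setT (fun w => w i) measurable.

Definition cylinder (R : realType) (k : nat) (n : nat) :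
    set_system (nat -> borelM R k) :=
  <<s \bigcup_(i in `I_n) @coord_sets R k i >>.

Definition Omega (R : realType) (k : nat) :=
  g_sigma_algebraType (\bigcup_i @coord_sets R k i).

Section channel.
Variables (R : realType) (k : nat).
Variable mu : {measure set (borelM R k) -> \bar R}.
Variable L : borelM R k -> borelM R k.

Definition phi (rho : 'M[R[i]]_k.+1) : 'M[R[i]]_k.+1 :=
  mxintegral mu (fun v => L v *m rho *m (L v) ^t*).

Definition stochastic : Prop :=
  mxintegral mu (fun v => (L v) ^t* *m L v) = 1%:M.

Definition square_integrable : Prop :=
  (\int[mu]_v (hsnorm (L v) ^+ 2)%:E < +oo)%E.

Definition corner (P : 'M[R[i]]_k.+1) : set 'M[R[i]]_k.+1 :=
  [set P *m A *m P | A in setT].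

Definition irreducible : Prop :=
  forall P : 'M[R[i]]_k.+1, P ^t* = P -> P *m P = P ->
    phi @` corner P `<=` corner P -> P = 0 \/ P = 1%:M.

(* nu \x^ mu is the product measure A |-> \int[mu]_v nu {x | (x, v) \in A},
   which needs no sigma-finiteness of mu. *)
Definition PiL (nu : probability (borelP R k) R) (S : set (borelP R k)) :
    \bar R :=
  (\int[nu \x^ mu]_z
     (\1_S (pact (L z.2) z.1) * hsnorm (L z.2 *m unit_rep z.1) ^+ 2)%:E)%E.

Definition invariant_for_Pi (nu : probability (borelP R k) R) : Prop :=
  forall S, measurable S -> PiL nu S = nu S.

Fixpoint W (n : nat) (w : nat -> borelM R k) : 'M[R[i]]_k.+1 :=
  if n is m.+1 then L (w m) *m W m w else 1%:M.

(* Integral with respect to the n-th power of mu of a function f of the first n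
   coordinates, as an iterated integral. As mu may fail to be sigma-finite, its
   powers need not be unambiguously defined, but the integrands below vanish
   unless every L(w i) is nonzero, and {L <> 0} is sigma-finite for mu by square
   integrability of L: Tonelli's theorem applies there. *)
Fixpoint power_integral (n : nat) (f : seq (borelM R k) -> \bar R) : \bar R :=
  if n is m.+1 then
    (\int[mu]_v power_integral m (fun s => f (v :: s)))%E
  else f [::].

(* A finite sequence s is completed into the element nth 0 s of the sequence
   space; for O in cylinder n, only its first n terms matter. *)
Definition is_Pnu (nu : probability (borelP R k) R)
    (P : probability (borelP R k * Omega R k)%type R) : Prop :=
  forall (n : nat) (S : set (borelP R k)) (O : set (nat -> borelM R k)),
    measurable S -> cylinder n O ->
    P (S `*` O) =
    (\int[nu]_(x in S) power_integral n (fun s =>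
       (\1_O (nth (0 : 'M[R[i]]_k.+1) s) *
        hsnorm (W n (nth (0 : 'M[R[i]]_k.+1) s) *m unit_rep x) ^+ 2)%:E))%E.

Definition X (n : nat) (z : borelP R k * Omega R k) : borelP R k :=
  pact (W n z.2) z.1.

End channel.

Definition barycenter (R : realType) (k : nat)
    (nu : probability (borelP R k) R) : 'M[R[i]]_k.+1 :=
  mxintegral nu (fun x => ppi x).

(* Main.v *)
(* The law of the pair (line, matrix) after one step is the measure Q with
   density |L(v)x|^2 with respect to nu (x) mu, and the new line L(v).x satisfies
   |L(v)x|^2 pi_{L(v).x} = L(v) pi_x L(v)^*. Hence the mean of pi at time 1 is
   phi(rho_nu) by Fubini, while invariance of nu says that the new line has law
   nu under Q, so that this mean is also rho_nu.
   Let L be irreducible. The difference D of two barycenters is Hermitian,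
   traceless and fixed by phi. Let P be the spectral projector of D on its
   positive eigenvalues. Comparing tr(PD) with tr(P phi(D)) shows that
   (1 - P) L(v) P = 0 for almost every v, whence phi preserves P M_k P and P is 0
   or 1; in both cases tr D = 0 forces D = 0. *)

From HB Require Import structures.
Require Import Defs.
From mathcomp Require Import all_boot all_order all_algebra spectral.
From mathcomp Require Import complex.
From mathcomp Require Import all_classical all_reals all_analysis.
From mathcomp Require Import measurable_realfun.
From mathcomp Require Import ring lra.

Set Implicit Arguments.
Unset Strict Implicit.
Unset Printing Implicit Defensive.

Import Order.TTheory GRing.Theory Num.Theory.
Import numFieldTopology.Exports numFieldNormedType.Exports.

Local Open Scope classical_set_scope.
Local Open Scope sesquilinear_scope.
Local Open Scope complex_scope.
Local Open Scope ring_scope.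

(** * Integration of complex and matrix valued functions *)

Section complex_integration.
Context d (T : measurableType d) (R : realType).
Implicit Types (m : {measure set T -> \bar R}) (f g : T -> R[i]).

(** Two obstacles shape the measure theory. A line is represented by an arbitrarily chosen unit
    vector, with no measurable dependence on the line, and [pact] returns a junk value where the
    matrix kills the line. Everything is therefore expressed through the entries of [ppi], which are
    Lipschitz for [pdist] and insensitive to the choice of phase. The new line is only tested
    through real functions whose composite with [jump] is known to be measurable. The measure [mu]
    is arbitrary, whereas Tonelli and Fubini concern sigma-finite measures. The integrands to be
    exchanged vanish wherever L(v) = 0, so product integrals are carried over to the restriction of
    [mu] to {L <> 0}, which is sigma-finite because the squared norm of L is integrable. *)

Definition cmeasurable f :=
  measurable_fun setT (fun t => complex.Re (f t)) /\
  measurable_fun setT (fun t => complex.Im (f t)).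

Definition cintegrable m f :=
  m.-integrable setT (fun t => (complex.Re (f t))%:E) /\
  m.-integrable setT (fun t => (complex.Im (f t))%:E).

Lemma integrableZl_EFin m (r : R) (h : T -> R) :
  m.-integrable setT (EFin \o h) ->
  m.-integrable setT (EFin \o (fun t => r * h t)).
Proof.
move=> ih; have := integrableZl measurableT r ih.
by apply: eq_integrable => // t _ /=; rewrite EFinM.
Qed.

Lemma cmeasurable_cst c : cmeasurable (cst c).
Proof. by split; exact: measurable_cst. Qed.

Lemma cmeasurableD f g :
  cmeasurable f -> cmeasurable g -> cmeasurable (fun t => f t + g t).
Proof.
move=> [fr fi] [gr gi]; split.
- rewrite (_ : (fun _ => _) = fun t => complex.Re (f t) + complex.Re (g t)).
    exact: measurable_funD.
  by apply/funext => t; case: (f t) => ? ?; case: (g t).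
- rewrite (_ : (fun _ => _) = fun t => complex.Im (f t) + complex.Im (g t)).
    exact: measurable_funD.
  by apply/funext => t; case: (f t) => ? ?; case: (g t).
Qed.

Lemma cmeasurableM f g :
  cmeasurable f -> cmeasurable g -> cmeasurable (fun t => f t * g t).
Proof.
move=> [fr fi] [gr gi]; split.
- rewrite (_ : (fun _ => _) = fun t => complex.Re (f t) * complex.Re (g t)
      - complex.Im (f t) * complex.Im (g t)).
    by apply: measurable_funB; exact: measurable_funM.
  by apply/funext => t; case: (f t) => ? ?; case: (g t).
- rewrite (_ : (fun _ => _) = fun t => complex.Re (f t) * complex.Im (g t)
      + complex.Im (f t) * complex.Re (g t)).
    by apply: measurable_funD; exact: measurable_funM.
  by apply/funext => t; case: (f t) => ? ?; case: (g t).
Qed.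

Lemma cmeasurable_sum (I : Type) (s : seq I) (F : I -> T -> R[i]) :
  (forall i, cmeasurable (F i)) -> cmeasurable (fun t => \sum_(i <- s) F i t).
Proof.
move=> mF; elim: s => [|i s IH].
  by under [X in cmeasurable X]eq_fun do rewrite big_nil; exact: cmeasurable_cst.
under [X in cmeasurable X]eq_fun do rewrite big_cons.
exact: cmeasurableD.
Qed.

Lemma cmeasurable_conj f : cmeasurable f -> cmeasurable (fun t => (f t)^*%R).
Proof.
move=> [fr fi]; split.
- rewrite (_ : (fun _ => _) = fun t => complex.Re (f t)) //.
  by apply/funext => t; case: (f t).
- rewrite (_ : (fun _ => _) = fun t => - complex.Im (f t)).
    exact: measurableT_comp.
  by apply/funext => t; case: (f t).
Qed.

Lemma cmeasurable_real (f : T -> R) :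
  measurable_fun setT f -> cmeasurable (fun t => (f t)%:C).
Proof. by move=> mf; split => //=; exact: measurable_cst. Qed.

Lemma cintegrable_measurable m f : cintegrable m f -> cmeasurable f.
Proof.
by move=> [fr fi]; split; apply/measurable_EFinP;
  [exact: (measurable_int _ fr)|exact: (measurable_int _ fi)].
Qed.

Lemma cintegrableD m f g :
  cintegrable m f -> cintegrable m g -> cintegrable m (fun t => f t + g t).
Proof.
move=> [fr fi] [gr gi]; split.
- have := integrableD measurableT fr gr; apply: eq_integrable => // t _ /=.
  by case: (f t) => ? ?; case: (g t).
- have := integrableD measurableT fi gi; apply: eq_integrable => // t _ /=.
  by case: (f t) => ? ?; case: (g t).
Qed.

Lemma cintegralD m f g : cintegrable m f -> cintegrable m g ->
  cintegral m (fun t => f t + g t) = cintegral m f + cintegral m g.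
Proof.
move=> [fr fi] [gr gi].
rewrite /cintegral; apply/eqP; rewrite eq_complex /=; apply/andP; split; apply/eqP.
- rewrite -RintegralD //; apply: eq_Rintegral => t _.
  by case: (f t) => ? ?; case: (g t).
- rewrite -RintegralD //; apply: eq_Rintegral => t _.
  by case: (f t) => ? ?; case: (g t).
Qed.

Lemma cintegrableZ m c f : cintegrable m f -> cintegrable m (fun t => c * f t).
Proof.
case: c => a b [fr fi]; split.
- have := integrableB measurableT
    (integrableZl measurableT a fr) (integrableZl measurableT b fi); apply: eq_integrable => // t _ /=.
  by case: (f t).
- have := integrableD measurableT
    (integrableZl measurableT a fi) (integrableZl measurableT b fr); apply: eq_integrable => // t _ /=.
  by case: (f t).
Qed.

Lemma cintegralZ m c f : cintegrable m f ->
  cintegral m (fun t => c * f t) = c * cintegral m f.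
Proof.
case: c => a b [fr fi].
rewrite /cintegral; apply/eqP; rewrite eq_complex /=; apply/andP; split; apply/eqP.
- rewrite -!RintegralZl // -RintegralB //; try exact: integrableZl_EFin.
  by apply: eq_Rintegral => t _; case: (f t).
- rewrite -!RintegralZl // -RintegralD //; try exact: integrableZl_EFin.
  by apply: eq_Rintegral => t _; case: (f t).
Qed.

Lemma cintegrable0 m : cintegrable m (cst 0).
Proof. by split; exact: integrable0. Qed.

Lemma cintegral0 m : cintegral m (cst 0) = 0.
Proof. by rewrite /cintegral /= !Rintegral_cst // !mul0r. Qed.

Lemma cintegrable_sum m (I : Type) (s : seq I) (F : I -> T -> R[i]) :
  (forall i, cintegrable m (F i)) ->
  cintegrable m (fun t => \sum_(i <- s) F i t).
Proof.
move=> mF; elim: s => [|i s IH].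
  by under [X in cintegrable _ X]eq_fun do rewrite big_nil; exact: cintegrable0.
under [X in cintegrable _ X]eq_fun do rewrite big_cons.
exact: cintegrableD.
Qed.

Lemma cintegral_sum m (I : Type) (s : seq I) (F : I -> T -> R[i]) :
  (forall i, cintegrable m (F i)) ->
  cintegral m (fun t => \sum_(i <- s) F i t) = \sum_(i <- s) cintegral m (F i).
Proof.
move=> mF; elim: s => [|i s IH].
  by under [X in cintegral _ X]eq_fun do rewrite big_nil; rewrite cintegral0 big_nil.
under [X in cintegral _ X]eq_fun do rewrite big_cons.
by rewrite cintegralD // ?big_cons ?IH //; exact: cintegrable_sum.
Qed.

Lemma cintegral_conj m f : cintegrable m f ->
  cintegral m (fun t => (f t)^*%R) = (cintegral m f)^*%R.
Proof.
move=> [fr fi].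
rewrite /cintegral; apply/eqP; rewrite eq_complex /=; apply/andP; split; apply/eqP.
- by apply: eq_Rintegral => t _; case: (f t).
- rewrite -mulN1r -RintegralZl //; apply: eq_Rintegral => t _.
  by case: (f t) => ? ?; rewrite /= mulN1r.
Qed.

Lemma normc_ge_Im (x : R[i]) : `|complex.Im x|%:C <= `|x|.
Proof.
case: x => a b.
by rewrite complex.normc_def /= lecR -[leLHS]sqrtr_sqr ler_wsqrtr // lerDr sqr_ge0.
Qed.

Lemma le_cintegrable m f (g : T -> R) : cmeasurable f ->
  m.-integrable setT (EFin \o g) -> (forall t, `|f t| <= (g t)%:C) ->
  cintegrable m f.
Proof.
move=> [fr fi] ig fg; split.
- apply: le_integrable ig => //; first exact/measurable_EFinP.
  move=> t _ /=; rewrite lee_fin (le_trans _ (ler_norm _)) //.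
  by rewrite -lecR (le_trans (normc_ge_Re _)).
- apply: le_integrable ig => //; first exact/measurable_EFinP.
  move=> t _ /=; rewrite lee_fin (le_trans _ (ler_norm _)) //.
  by rewrite -lecR (le_trans (normc_ge_Im _)).
Qed.

Lemma ae_eq_cintegral m f g : cmeasurable f -> cmeasurable g ->
  ae_eq m setT f g -> cintegral m f = cintegral m g.
Proof.
move=> [fr fi] [gr gi] fg; rewrite /cintegral /Rintegral; congr (fine _ +i* fine _).
- apply: ae_eq_integral => //; try exact/measurable_EFinP.
  by apply: filterS fg => t /= + _ => ->.
- apply: ae_eq_integral => //; try exact/measurable_EFinP.
  by apply: filterS fg => t /= + _ => ->.
Qed.

Definition mxintegrable m n p (F : T -> 'M[R[i]]_(n, p)) :=
  forall i j, cintegrable m (fun t => F t i j).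

Definition mxmeasurable n p (F : T -> 'M[R[i]]_(n, p)) :=
  forall i j, cmeasurable (fun t => F t i j).

Lemma mxmeasurable_mulmx n p q (F : T -> 'M[R[i]]_(n, p))
    (G : T -> 'M[R[i]]_(p, q)) :
  mxmeasurable F -> mxmeasurable G -> mxmeasurable (fun t => F t *m G t).
Proof.
move=> mF mG i j; under [X in cmeasurable X]eq_fun do rewrite mxE.
by apply: cmeasurable_sum => l; exact: cmeasurableM.
Qed.

Lemma mxmeasurable_trmxC n p (F : T -> 'M[R[i]]_(n, p)) :
  mxmeasurable F -> mxmeasurable (fun t => (F t) ^t*).
Proof.
move=> mF i j; under [X in cmeasurable X]eq_fun do rewrite !mxE.
exact: cmeasurable_conj.
Qed.

Lemma mxmeasurable_cst n p (A : 'M[R[i]]_(n, p)) : mxmeasurable (cst A).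
Proof. by move=> i j; exact: cmeasurable_cst. Qed.

Lemma mxintegrable_mulmx m n p q r (A : 'M[R[i]]_(n, p)) F (B : 'M[R[i]]_(q, r)) :
  @mxintegrable m p q F -> mxintegrable m (fun t => A *m F t *m B).
Proof.
move=> iF i j; under [X in cintegrable _ X]eq_fun do rewrite mxE.
apply: cintegrable_sum => l; under [X in cintegrable _ X]eq_fun do rewrite mulrC.
apply: cintegrableZ; under [X in cintegrable _ X]eq_fun do rewrite mxE.
by apply: cintegrable_sum => a; exact: cintegrableZ.
Qed.

Lemma mxintegral_mulmx m n (A B : 'M[R[i]]_n) F : mxintegrable m F ->
  mxintegral m (fun t => A *m F t *m B) = A *m mxintegral m F *m B.
Proof.
move=> iF; have iAF : mxintegrable m (fun t => A *m F t).
  by have := mxintegrable_mulmx A 1%:M iF; under eq_fun do rewrite mulmx1.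
apply/matrixP => i j; rewrite !mxE.
under eq_fun do rewrite mxE.
rewrite cintegral_sum; last first.
  by move=> l; under eq_fun do rewrite mulrC; exact: cintegrableZ.
apply: eq_bigr => l _.
under eq_fun do rewrite mulrC.
rewrite cintegralZ // mulrC; congr (_ * _); rewrite mxE.
under eq_fun do rewrite mxE.
rewrite cintegral_sum; last by move=> a; exact: cintegrableZ.
by apply: eq_bigr => a _; rewrite cintegralZ // mxE.
Qed.

Lemma cintegral_mxtrace m n F : @mxintegrable m n n F ->
  cintegral m (fun t => \tr (F t)) = \tr (mxintegral m F).
Proof.
move=> iF; rewrite /mxtrace cintegral_sum; last by move=> i; exact: iF.
by apply: eq_bigr => i _; rewrite mxE.
Qed.

End complex_integration.

(** * Densities and images of measures *)

(** The proofs [mh] and [h_ge0] are carried by the term so that the measure structure declared below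
    can be inferred from the term alone. *)
Definition mdensity d (T : measurableType d) (R : realType)
    (m : {measure set T -> \bar R}) (h : T -> R) (mh : measurable_fun setT h)
    (h_ge0 : forall t, 0 <= h t) (A : set T) : \bar R :=
  (\int[m]_(t in A) (h t)%:E)%E.

Section density.
Context d (T : measurableType d) (R : realType).
Variable m : {measure set T -> \bar R}.
Variables (h : T -> R) (mh : measurable_fun setT h) (h_ge0 : forall t, 0 <= h t).

Let mdensity0 : mdensity m mh h_ge0 set0 = 0%E.
Proof. exact: integral_set0. Qed.

Let mdensity_ge0 A : (0 <= mdensity m mh h_ge0 A)%E.
Proof. by apply: integral_ge0 => t _; rewrite lee_fin. Qed.

Let mdensity_sigma_additive : semi_sigma_additive (mdensity m mh h_ge0).
Proof.
apply: semi_sigma_additive_nng_induced => [|t]; last by rewrite lee_fin.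
exact/measurable_EFinP.
Qed.

HB.instance Definition _ := isMeasure.Build _ _ _ (mdensity m mh h_ge0)
  mdensity0 mdensity_ge0 mdensity_sigma_additive.

Import HBNNSimple.

(** Monotone convergence along simple functions increasing to [f] reduces both sides to sums over
    levels; on each level set the identity is the definition of [mdensity]. *)
Lemma ge0_integral_mdensity (f : T -> \bar R) :
  measurable_fun setT f -> (forall t, 0 <= f t)%E ->
  (\int[mdensity m mh h_ge0]_t f t = \int[m]_t (f t * (h t)%:E))%E.
Proof.
move=> mf f0; pose f_ := nnsfun_approx measurableT mf.
transitivity (limn (fun n => \int[mdensity m mh h_ge0]_t (f_ n t)%:E)%E).
  rewrite -monotone_convergence//.
  - apply: eq_integral => t _; apply/esym/cvg_lim => //.
    by apply: cvg_nnsfun_approx=> // *; apply: f0; rewrite inE.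
  - by move=> n; exact/measurable_EFinP/measurable_funP.
  - by move=> n y _; rewrite lee_fin.
  - by move=> y _ a b ab; rewrite lee_fin; exact/lefP/nd_nnsfun_approx.
transitivity (limn (fun n => \int[m]_t ((f_ n t)%:E * (h t)%:E))%E); last first.
  rewrite -monotone_convergence//.
  - apply: eq_integral => t _; apply/cvg_lim => //.
    apply: cvgeZr => //; apply: cvg_nnsfun_approx=> // *.
  - move=> n; apply: emeasurable_funM; exact/measurable_EFinP.
  - by move=> n y _; rewrite -EFinM lee_fin mulr_ge0.
  - move=> y _ a b ab; rewrite lee_wpmul2r ?lee_fin //.
    exact/lefP/nd_nnsfun_approx.
congr (limn _); apply/funext => n.
have mA r : measurable (f_ n @^-1` [set r]) by exact: measurable_sfunP.
transitivity (\sum_(r \in range (f_ n))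
    (r%:E * mdensity m mh h_ge0 (f_ n @^-1` [set r])))%E.
  under eq_integral do rewrite fimfunE -fsumEFin//.
  rewrite ge0_integral_fsum//; last 2 first.
  - by move=> y; exact/measurable_EFinP/measurable_funM.
  - by move=> y x _; rewrite nnfun_muleindic_ge0.
  by apply: eq_fsbigr => r _; rewrite integralZl_indic_nnsfun// integral_indic// setIT.
rewrite [RHS](_ : _ = (\int[m]_t (\sum_(r \in range (f_ n))
    (r%:E * ((\1_(f_ n @^-1` [set r]) t)%:E * (h t)%:E))))%E).
  rewrite ge0_integral_fsum//; last 2 first.
  - move=> r; apply/measurable_funeM; apply: emeasurable_funM;
      exact/measurable_EFinP.
  - move=> r t _; rewrite muleA mule_ge0 ?lee_fin //.
    exact: nnfun_muleindic_ge0.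
  (* The level is rewritten as a value of the approximant: its nonnegativity allows it to be taken
     out of the integral. *)
  apply: eq_fsbigr => r; rewrite inE => -[t _ <-].
  rewrite ge0_integralZl //; last 3 first.
  - apply: emeasurable_funM; exact/measurable_EFinP.
  - by move=> x _; rewrite mule_ge0 ?lee_fin.
  - by rewrite lee_fin.
  rewrite /mdensity integral_mkcond; congr (_ * _)%E.
  apply: eq_integral => x _; rewrite patchE indicE.
  by case: ifPn; rewrite ?mul1e ?mul0e.
apply: eq_integral => t _; rewrite fimfunE -fsumEFin//.
rewrite ge0_mule_fsuml; last by move=> r; exact: nnfun_muleindic_ge0.
by apply: eq_fsbigr => r _; rewrite EFinM muleA.
Qed.

(** As [h] is nonnegative, multiplication by it commutes with taking positive and negative parts. *)
Lemma integral_mdensity (f : T -> R) : measurable_fun setT f ->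
  (\int[mdensity m mh h_ge0]_t (f t)%:E = \int[m]_t (f t * h t)%:E)%E.
Proof.
move=> mf; have mF : measurable_fun setT (EFin \o f) by exact/measurable_EFinP.
rewrite [LHS]integralE [RHS]integralE; congr (_ - _)%E.
- rewrite ge0_integral_mdensity //; last exact: measurable_funepos.
  apply: eq_integral => t _; rewrite !funeposE /= -EFin_max -EFinM.
by rewrite maxr_pMl // mul0r EFin_max.
- rewrite ge0_integral_mdensity //; last exact: measurable_funeneg.
  apply: eq_integral => t _; rewrite !funenegE /= -EFin_max -EFinM.
  by rewrite maxr_pMl // mul0r mulNr EFin_max.
Qed.

Lemma cintegral_mdensity (f : T -> R[i]) : cmeasurable f ->
  cintegral (mdensity m mh h_ge0) f = cintegral m (fun t => (h t)%:C * f t).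
Proof.
move=> [fr fi]; rewrite /cintegral /Rintegral !integral_mdensity //.
congr (fine _ +i* fine _).
- by apply: eq_integral => t _; case: (f t) => a b /=; rewrite mul0r subr0 mulrC.
- by apply: eq_integral => t _; case: (f t) => a b /=; rewrite mul0r addr0 mulrC.
Qed.

End density.

Section bounded_cintegrable.
Context d (T : measurableType d) (R : realType).

Lemma bounded_cintegrable (m : {finite_measure set T -> \bar R})
    (f : T -> R[i]) (c : R) :
  cmeasurable f -> (forall t, `|f t| <= c%:C) -> cintegrable m f.
Proof.
move=> mf fc; apply: (le_cintegrable mf _ fc).
exact: finite_measure_integrable_cst.
Qed.

End bounded_cintegrable.

Section change_of_variables.
Context d1 d2 d (T1 : measurableType d1) (T2 : measurableType d2)
  (Y : measurableType d) (R : realType).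
Variables (m1 : {measure set T1 -> \bar R}) (m2 : {measure set T2 -> \bar R}).
Variables (f1 : T1 -> Y) (f2 : T2 -> Y).
Hypotheses (mf1 : measurable_fun setT f1) (mf2 : measurable_fun setT f2).
Hypothesis m12 :
  forall B, measurable B -> m1 (f1 @^-1` B) = m2 (f2 @^-1` B).

(** Both sides are the integral of [g] for the common image measure of [f1] and [f2] on [Y]. *)
Let ge0_eq_integral_image (g : Y -> \bar R) :
  measurable_fun setT g -> (forall y, 0 <= g y)%E ->
  (\int[m1]_x g (f1 x) = \int[m2]_x g (f2 x))%E.
Proof.
move=> mg g0.
have := ge0_integral_pushforward mf1 m1 measurableT mg (fun y _ => g0 y).
have := ge0_integral_pushforward mf2 m2 measurableT mg (fun y _ => g0 y).
rewrite !preimage_setT => <- <-.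
by apply: eq_measure_integral => A mA _; exact: m12.
Qed.

Lemma eq_integral_image (g : Y -> R) : measurable_fun setT g ->
  (\int[m1]_x (g (f1 x))%:E = \int[m2]_x (g (f2 x))%:E)%E.
Proof.
move=> mg; have mG : measurable_fun setT (EFin \o g) by exact/measurable_EFinP.
rewrite [LHS]integralE [RHS]integralE; congr (_ - _)%E.
- have := ge0_eq_integral_image (measurable_funepos mG) (funepos_ge0 _).
  under eq_integral do rewrite funeposE.
  under [RHS]eq_integral do rewrite funeposE.
  move=> E; under eq_integral do rewrite funeposE.
  by under [RHS]eq_integral do rewrite funeposE.
- have := ge0_eq_integral_image (measurable_funeneg mG) (funeneg_ge0 _).
  under eq_integral do rewrite funenegE.
  under [RHS]eq_integral do rewrite funenegE.
  move=> E; under eq_integral do rewrite funenegE.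
  by under [RHS]eq_integral do rewrite funenegE.
Qed.

Lemma eq_cintegral_image (g : Y -> R[i]) : cmeasurable g ->
  cintegral m1 (g \o f1) = cintegral m2 (g \o f2).
Proof.
by move=> [gr gi]; rewrite /cintegral /Rintegral (eq_integral_image gr)
  (eq_integral_image gi).
Qed.

End change_of_variables.

(** * The projective space *)

Section hsnorm_theory.
Variable R : realType.
Local Notation C := R[i].

Lemma realcX (a : R) n : (a ^+ n)%:C = a%:C ^+ n :> C.
Proof. exact: (rmorphXn (real_complex R)). Qed.

Lemma mxtrace_mulC_trmxC m n (A : 'M[C]_(m, n)) :
  \tr (A *m A ^t*) = \sum_i \sum_j `|A i j| ^+ 2.
Proof.
apply: eq_bigr => i _; rewrite mxE; apply: eq_bigr => j _.
by rewrite !mxE normCK.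
Qed.

(** The trace is a sum of squared moduli, hence real and nonnegative: neither the real part nor the
    square root in [hsnorm] loses anything. *)
Lemma hsnorm_sqr m n (A : 'M[C]_(m, n)) :
  (hsnorm A ^+ 2)%:C = \tr (A *m A ^t*).
Proof.
have h0 : 0 <= \tr (A *m A ^t*).
  rewrite mxtrace_mulC_trmxC.
  by apply: sumr_ge0 => i _; apply: sumr_ge0 => j _; rewrite exprn_ge0.
rewrite /hsnorm sqr_sqrtr ?RRe_real ?ger0_real //.
by rewrite -lecR RRe_real ?ger0_real.
Qed.

Lemma hsnorm_ge0 m n (A : 'M[C]_(m, n)) : 0 <= hsnorm A.
Proof. exact: sqrtr_ge0. Qed.

Lemma normr_le_hsnorm m n (A : 'M[C]_(m, n)) i j : `|A i j| <= (hsnorm A)%:C.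
Proof.
rewrite -(@ler_pXn2r _ 2) // ?nnegrE ?ler0c ?hsnorm_ge0 //.
rewrite -(realcX (hsnorm A)) hsnorm_sqr mxtrace_mulC_trmxC (bigD1 i) //= (bigD1 j) //=.
rewrite -addrA lerDl addr_ge0 //.
  by apply: sumr_ge0 => l _; rewrite exprn_ge0.
by apply: sumr_ge0 => l _; apply: sumr_ge0 => o _; rewrite exprn_ge0.
Qed.

Lemma hsnorm_eq0 m n (A : 'M[C]_(m, n)) : (hsnorm A == 0) = (A == 0).
Proof.
apply/eqP/eqP => [h0|->]; last first.
  by rewrite /hsnorm mul0mx mxtrace0 /= sqrtr0.
apply/matrixP => i j; rewrite mxE; apply/eqP; rewrite -normr_le0.
by rewrite (le_trans (normr_le_hsnorm A i j)) // h0.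
Qed.

Lemma mx_subE m n (A B : 'M[C]_(m, n)) i j : (A - B) i j = A i j - B i j.
Proof. by rewrite !mxE. Qed.

Lemma mx_scaleE m n c (A : 'M[C]_(m, n)) i j : (c *: A) i j = c * A i j.
Proof. by rewrite mxE. Qed.

Lemma trmxCE m n (A : 'M[C]_(m, n)) i j : (A ^t*) i j = (A j i)^*%R.
Proof. by rewrite !mxE. Qed.

Lemma trmxC_mul m n p (A : 'M[C]_(m, n)) (B : 'M[C]_(n, p)) :
  (A *m B) ^t* = B ^t* *m A ^t*.
Proof. by rewrite trmx_mul map_mxM. Qed.

Lemma trmxC_scale m n c (A : 'M[C]_(m, n)) : (c *: A) ^t* = c^*%R *: A ^t*.
Proof. by apply/matrixP => i j; rewrite !mxE rmorphM. Qed.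

Lemma trmxC_sub m n (A B : 'M[C]_(m, n)) : (A - B) ^t* = A ^t* - B ^t*.
Proof. by apply/matrixP => i j; rewrite !mxE rmorphB. Qed.

End hsnorm_theory.

Section projective_theory.
Variables (R : realType) (k : nat).
Local Notation C := R[i].
Implicit Types (x y : projective R k) (A : 'M[C]_k.+1).


Lemma hsnormZ m n c (B : 'M[C]_(m, n)) :
  (hsnorm (c *: B) ^+ 2)%:C = `|c| ^+ 2 * (hsnorm B ^+ 2)%:C.
Proof.
rewrite !hsnorm_sqr trmxC_scale -scalemxAl -scalemxAr !mxtraceZ mulrA normCK //.
Qed.

Lemma hsnorm_unit_rep x : hsnorm (unit_rep x) = 1.
Proof.
have v0 : hsnorm (vpick x) != 0.
  rewrite hsnorm_eq0 vpick0; case: x => V /=.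
  by apply: contraTneq => ->; rewrite dimv0.
apply/eqP; rewrite -(@pexpr_eq1 _ _ 2) ?hsnorm_ge0 //.
apply/eqP/complexI; rewrite hsnormZ ger0_norm ?ler0c ?invr_ge0 ?hsnorm_ge0 //.
by rewrite -realcX -(rmorphM (real_complex R)) /= exprVn mulVf // expf_neq0.
Qed.

Lemma unit_rep_mulC x : (unit_rep x) ^t* *m unit_rep x = 1%:M.
Proof.
apply/matrixP => i j; rewrite !ord1 [RHS]mxE eqxx mulr1n.
rewrite -trace_mx11 mxtrace_mulC -hsnorm_sqr hsnorm_unit_rep.
by rewrite expr1n.
Qed.

Lemma mxtrace_ppi x : \tr (ppi x) = 1.
Proof. by rewrite /ppi -hsnorm_sqr hsnorm_unit_rep expr1n. Qed.

Lemma ppi_herm x : (ppi x) ^t* = ppi x.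
Proof. by rewrite /ppi trmxC_mul trmxCK. Qed.

Lemma normr_ppi_le1 x i j : `|ppi x i j| <= 1.
Proof.
rewrite /ppi mxE big_ord1 trmxCE normrM norm_conjC.
have h l : `|unit_rep x l 0| <= 1.
  by have := normr_le_hsnorm (unit_rep x) l 0; rewrite hsnorm_unit_rep.
by rewrite mulr_ile1.
Qed.

(** The right-hand side involves the chosen vector through [ppi x] only; this is what makes the
    one-step weight measurable. *)
Lemma hsnorm_mulmx_unit_rep m (A : 'M[C]_(m, k.+1)) x :
  (hsnorm (A *m unit_rep x) ^+ 2)%:C = \tr (A *m ppi x *m A ^t*).
Proof. by rewrite hsnorm_sqr trmxC_mul /ppi !mulmxA. Qed.

Lemma memv_unit_rep x : unit_rep x \in line x.
Proof. by rewrite memvZ // memv_pick. Qed.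

Lemma unit_rep_neq0 x : unit_rep x != 0.
Proof. by rewrite -hsnorm_eq0 hsnorm_unit_rep oner_eq0. Qed.

Lemma line_unit_rep x : line x = <[unit_rep x]>%VS.
Proof.
apply/esym/eqP; rewrite eqEdim -memvE memv_unit_rep dim_vline unit_rep_neq0.
by case: x => V /= /eqP ->.
Qed.


Lemma line_pact A x : A *m unit_rep x != 0 ->
  line (pact A x) = <[A *m unit_rep x]>%VS.
Proof. by move=> Ax0; rewrite [LHS]insubdK // -topredE /= dim_vline Ax0. Qed.

Lemma pact_junk A x : A *m unit_rep x = 0 -> pact A x = x.
Proof. by move=> Ax0; rewrite /pact /insubd insubF // dim_vline Ax0 eqxx. Qed.

Lemma pact1 x : pact 1%:M x = x.
Proof.
apply/val_inj => /=.
by rewrite line_pact mul1mx ?unit_rep_neq0 // -line_unit_rep.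
Qed.

(** The chosen unit vector of the new line is c w with w the image vector and |c|^2 |w|^2 = 1, so
    the phase of c cancels. If w = 0 both sides vanish, whatever the junk value of [pact]. *)
Lemma ppi_pact A x : (hsnorm (A *m unit_rep x) ^+ 2)%:C *: ppi (pact A x) =
  A *m ppi x *m A ^t*.
Proof.
set w := A *m unit_rep x; have [w0|w0] := eqVneq w 0.
  rewrite w0 (_ : hsnorm 0 = 0) ?expr0n /= ?scale0r; last first.
    by apply/eqP; rewrite hsnorm_eq0.
  by rewrite /ppi mulmxA -/w w0 !mul0mx.
have := memv_unit_rep (pact A x); rewrite line_pact // -/w => /vlineP[c uc].
have c1 : `|c| ^+ 2 * (hsnorm w ^+ 2)%:C = 1.
  by rewrite -hsnormZ -uc hsnorm_unit_rep expr1n.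
rewrite /ppi uc trmxC_scale -scalemxAl -scalemxAr !scalerA -mulrA -normCK.
by rewrite mulrC c1 scale1r trmxC_mul !mulmxA.
Qed.

(** For rank one projectors P and Q, the squared norm of P - Q is 2 - 2 tr(PQ), and tr(PQ) is the
    squared modulus of the inner product. Thus [pdist] is, up to a factor, the distance between
    projectors. *)
Lemma hsnorm_ppi_sub x y : hsnorm (ppi x - ppi y) ^+ 2 =
  2 * (1 - cabs (inner (unit_rep x) (unit_rep y)) ^+ 2).
Proof.
have pp (z : projective R k) : ppi z *m ppi z = ppi z.
  rewrite /ppi; move: (unit_rep z) (unit_rep_mulC z) => u uu.
  by rewrite mulmxA -(mulmxA u) uu mulmx1.
have pq : \tr (ppi x *m ppi y) = `|inner (unit_rep x) (unit_rep y)| ^+ 2.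
  rewrite /ppi /inner; move: (unit_rep x) (unit_rep y) => u v.
  rewrite mulmxA -(mulmxA u) mxtrace_mulC (mulmxA (v ^t*)) trace_mx11 mxE big_ord1.
  rewrite normCK mulrC; congr (_ * _).
  by rewrite -trmxCE trmxC_mul trmxCK.
have cE : `|inner (unit_rep x) (unit_rep y)| =
    (cabs (inner (unit_rep x) (unit_rep y)))%:C.
  by rewrite /cabs RRe_real ?ger0_real.
move: pq; rewrite cE; move: (cabs _) => c.
move: (ppi_herm x) (ppi_herm y) (pp x) (pp y) (mxtrace_ppi x) (mxtrace_ppi y).
move: (ppi x) (ppi y) => P Q hP hQ PP QQ tP tQ PQ.
apply: (@complexI R); rewrite hsnorm_sqr trmxC_sub hP hQ mulmxBl !mulmxBr.
rewrite !(raddfB (@mxtrace _ _)) /= (mxtrace_mulC Q P) PP QQ tP tQ PQ.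
rewrite (rmorphM (real_complex R)) (rmorphB (real_complex R)).
rewrite (rmorph_nat (real_complex R)) (rmorph1 (real_complex R)).
by rewrite (rmorphXn (real_complex R)) /=; ring.
Qed.

(** The factor 2 is a rounding of the square root of 2. The preceding identity also supplies
    Cauchy-Schwarz, needed because [Num.sqrt] is 0 on negative numbers. *)
Lemma hsnorm_ppi_sub_le x y : hsnorm (ppi x - ppi y) <= 2 * pdist x y.
Proof.
rewrite -(@ler_pXn2r _ 2) ?nnegrE ?hsnorm_ge0 ?mulr_ge0 ?sqrtr_ge0 //.
have := sqr_ge0 (hsnorm (ppi x - ppi y)); rewrite exprMn hsnorm_ppi_sub => h.
by rewrite sqr_sqrtr; nra.
Qed.

Lemma lipschitz_measurable (f : borelP R k -> R) :
  (forall x y : projective R k, `|f x - f y| <= 2 * pdist x y) ->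
  measurable_fun setT f.
Proof.
move=> fl; apply: (measurability _ (RGenOInfty.measurableE R)).
move=> _ [_ [a ->] <-]; rewrite setTI; apply: sub_sigma_algebra => x /=.
(* The radius is the room above [a] divided by the Lipschitz constant 2. *)
rewrite in_itv /= andbT => ax; exists ((f x - a) / 2) => [|y /= xy].
  by rewrite divr_gt0 // subr_gt0.
rewrite in_itv /= andbT.
have := fl x y; have := ler_norm (f x - f y) => h1 h2; lra.
Qed.

Lemma mxmeasurable_ppi : mxmeasurable (@ppi R k : borelP R k -> _).
Proof.
have ppiB x y i j : `|ppi x i j - ppi y i j| <= (2 * pdist x y)%:C.
  have := normr_le_hsnorm (ppi x - ppi y) i j; rewrite mx_subE.
  by move/le_trans; apply; rewrite lecR hsnorm_ppi_sub_le.
have ReImB (a b : C) (r : R) : `|a - b| <= r%:C ->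
    `|complex.Re a - complex.Re b| <= r /\ `|complex.Im a - complex.Im b| <= r.
  move=> abr; rewrite -!lecR; split.
  - apply: le_trans abr; apply: le_trans (normc_ge_Re _).
    by case: a => ? ?; case: b.
  - apply: le_trans abr; apply: le_trans (normc_ge_Im _).
    by case: a => ? ?; case: b.
by move=> i j; split; apply: lipschitz_measurable => x y;
  have [] := ReImB _ _ _ (ppiB x y i j).
Qed.

Lemma continuous_measurable_borelM (f : 'M[C^o]_k.+1 -> R) :
  continuous f -> measurable_fun setT (f : borelM R k -> R).
Proof.
move=> cf; apply: (measurability _ (RGenOInfty.measurableE R)).
move=> _ [_ [a ->] <-]; rewrite setTI; apply: sub_sigma_algebra.
by move/continuousP : cf; apply; exact: interval_open.
Qed.

Lemma continuous_Re : continuous (@complex.Re R : C^o -> R).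
Proof.
move=> z s /= /nbhs_ballP[e /= e0 es]; apply/nbhs_ballP.
exists e%:C; first by rewrite /= ltcR.
move=> y zy; apply: es; rewrite /ball /= -ltcR; apply: le_lt_trans zy.
apply: le_trans (normc_ge_Re _).
by case: z => ? ?; case: y.
Qed.

Lemma continuous_Im : continuous (@complex.Im R : C^o -> R).
Proof.
move=> z s /= /nbhs_ballP[e /= e0 es]; apply/nbhs_ballP.
exists e%:C; first by rewrite /= ltcR.
move=> y zy; apply: es; rewrite /ball /= -ltcR; apply: le_lt_trans zy.
apply: le_trans (normc_ge_Im _).
by case: z => ? ?; case: y.
Qed.

Lemma mxmeasurable_borelM : mxmeasurable (id : borelM R k -> 'M[C]_k.+1).
Proof.
move=> i j; split; apply: continuous_measurable_borelM => A.
- exact: (continuous_comp (@coord_continuous _ _ _ i j A) (@continuous_Re _)).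
- exact: (continuous_comp (@coord_continuous _ _ _ i j A) (@continuous_Im _)).
Qed.

End projective_theory.

Lemma cmeasurable_comp d1 d2 (T1 : measurableType d1) (T2 : measurableType d2)
    (R : realType) (f : T2 -> R[i]) (g : T1 -> T2) :
  cmeasurable f -> measurable_fun setT g -> cmeasurable (f \o g).
Proof.
move=> [fr fi] mg; split.
- exact: (measurableT_comp fr mg).
- exact: (measurableT_comp fi mg).
Qed.

(** * Measurability of one jump, jointly in the line and the matrix *)

Section joint_measurability.
Variables (R : realType) (k : nat) (L : borelM R k -> borelM R k).
Hypothesis mL : measurable_fun setT L.
Implicit Type z : borelP R k * borelM R k.

Lemma mxmeasurable_L : mxmeasurable (L : borelM R k -> 'M[R[i]]_k.+1).
Proof. by move=> i j; have := cmeasurable_comp (@mxmeasurable_borelM R k i j) mL. Qed.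

Lemma mxmeasurable_jump :
  mxmeasurable (fun z => (L z.2 : 'M[R[i]]_k.+1) *m ppi z.1 *m (L z.2) ^t*).
Proof.
apply: mxmeasurable_mulmx; last first.
  apply: mxmeasurable_trmxC => i j.
  exact: (cmeasurable_comp (mxmeasurable_L i j) measurable_snd).
apply: mxmeasurable_mulmx => i j.
  exact: (cmeasurable_comp (mxmeasurable_L i j) measurable_snd).
exact: (cmeasurable_comp (@mxmeasurable_ppi R k i j) measurable_fst).
Qed.

Definition weight z : R := hsnorm ((L z.2 : 'M[R[i]]_k.+1) *m unit_rep z.1) ^+ 2.

Lemma weight_ge0 z : 0 <= weight z.
Proof. exact: sqr_ge0. Qed.

Lemma weightE z :
  (weight z)%:C = \tr ((L z.2 : 'M[R[i]]_k.+1) *m ppi z.1 *m (L z.2) ^t*).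
Proof. exact: hsnorm_mulmx_unit_rep. Qed.

Lemma measurable_weight : measurable_fun setT weight.
Proof.
have [+ _] : cmeasurable (fun z =>
    \tr ((L z.2 : 'M[R[i]]_k.+1) *m ppi z.1 *m (L z.2) ^t*)).
  by apply: cmeasurable_sum => i; exact: mxmeasurable_jump.
by under eq_fun do rewrite -weightE.
Qed.

Definition jump z : borelP R k := pact (L z.2) z.1.

Lemma weight_ppi_jump z : (weight z)%:C *: ppi (jump z) =
  (L z.2 : 'M[R[i]]_k.+1) *m ppi z.1 *m (L z.2) ^t*.
Proof. exact: ppi_pact. Qed.

(** Solves [weight_ppi_jump] for the projector with measurable terms only. Where the weight is 0 the
    first term vanishes and the line stays in place, by the junk value of [pact]; the indicator
    accounts for that. The inverse is written as a real power because [powR] with a fixed exponent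
    is measurable. *)
Lemma ppi_jumpE z i j : ppi (jump z) i j =
  (weight z `^ (-1))%:C * ((L z.2 : 'M[R[i]]_k.+1) *m ppi z.1 *m (L z.2) ^t*) i j
  + (\1_(weight @^-1` [set 0]) z)%:C * ppi z.1 i j.
Proof.
have /matrixP/(_ i j) := weight_ppi_jump z; rewrite mx_scaleE => <-.
rewrite powR_inv1 ?weight_ge0 //.
have [w0|w0] := eqVneq (weight z) 0.
  rewrite w0 !(mul0r, mulr0) add0r indicE mem_set // mul1r.
  rewrite /jump pact_junk //; apply/eqP; rewrite -hsnorm_eq0.
  by move/eqP: w0; rewrite sqrf_eq0.
rewrite indicE memNset ?mul0r ?addr0; last exact/eqP.
by rewrite mulrA -(rmorphM (real_complex R)) /= mulVf // mul1r.
Qed.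

Lemma mxmeasurable_ppi_jump : mxmeasurable (fun z => ppi (jump z)).
Proof.
move=> i j; under [X in cmeasurable X]eq_fun do rewrite ppi_jumpE.
apply: cmeasurableD; apply: cmeasurableM.
- apply: cmeasurable_real.
  exact: (measurableT_comp (measurable_powR _) measurable_weight).
- exact: mxmeasurable_jump.
- apply: cmeasurable_real; apply: measurable_indic.
  by rewrite -[X in measurable X]setTI; exact: measurable_weight.
- exact: (cmeasurable_comp (@mxmeasurable_ppi R k i j) measurable_fst).
Qed.

End joint_measurability.

(** * Tonelli and Fubini over an arbitrary measure *)

Section support_measurable.
Context d (T : measurableType d) (R : realType).
Variables (h : T -> R) (mh : measurable_fun setT h).

Lemma measurable_support : measurable (h @^-1` [set~ 0]).
Proof.
by rewrite -[X in measurable X]setTI; apply: mh => //; exact: measurableC.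
Qed.

End support_measurable.

(* An arbitrary measure becomes sigma-finite when restricted to the support of
   an integrable function: this gives access to Tonelli's theorem. *)
Definition msupport d (T : measurableType d) (R : realType)
    (m : {measure set T -> \bar R}) (h : T -> R) (mh : measurable_fun setT h)
    (h_ge0 : forall t, 0 <= h t) (ih : (\int[m]_t (h t)%:E < +oo)%E) :=
  mrestr m (measurable_support mh).

Section msupport_theory.
Context d (T : measurableType d) (R : realType).
Variable m : {measure set T -> \bar R}.
Variables (h : T -> R) (mh : measurable_fun setT h) (h_ge0 : forall t, 0 <= h t).
Hypothesis ih : (\int[m]_t (h t)%:E < +oo)%E.
Local Notation m' := (msupport mh h_ge0 ih).

HB.instance Definition _ := Measure.on m'.

(** Markov's inequality bounds the measure of {h >= 1/(n+1)} by n+1 times the integral of [h].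
    Adding {h = 0}, which is null for the restricted measure, makes these sets cover the space. *)
Let msupport_sigma_finite : sigma_finite setT m'.
Proof.
pose F n := h @^-1` [set 0] `|` h @^-1` `[n.+1%:R^-1, +oo[.
have mF n : measurable (F n).
  by apply: measurableU; rewrite -[X in measurable X]setTI; exact: mh.
have mG n : measurable (h @^-1` `[n.+1%:R^-1, +oo[).
  by rewrite -[X in measurable X]setTI; exact: mh.
exists F => [|n].
  apply/seteqP; split=> // t _; have [h0|h0] := eqVneq (h t) 0.
    by exists 0%N => //; left.
  have ht : 0 < h t by rewrite lt_neqAle eq_sym h0 h_ge0.
  exists (Num.truncn (h t)^-1) => //; right => /=.
  rewrite in_itv /= andbT invf_ple ?posrE //.
  by rewrite ltW // truncnS_gt.
split => //; rewrite /msupport /mrestr.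
apply: (@le_lt_trans _ _ (m (h @^-1` `[n.+1%:R^-1, +oo[))).
  apply: le_measure; rewrite ?inE //.
    by apply: measurableI => //; exact: measurable_support.
  by move=> t [[]//].
have nh : ((n.+1%:R^-1)%:E * m (h @^-1` `[n.+1%:R^-1%R, +oo[) < +oo)%E.
  apply: le_lt_trans ih.
  rewrite -integral_cst //.
  apply: (@le_trans _ _ (\int[m]_(t in h @^-1` `[n.+1%:R^-1%R, +oo[) (h t)%:E)%E).
    apply: ge0_le_integral => //.
    - by move=> t _; rewrite lee_fin.
    - exact/measurable_EFinP/measurable_funTS.
    - by move=> t /=; rewrite in_itv /= andbT lee_fin.
  apply: ge0_subset_integral => //; first exact/measurable_EFinP.
  by move=> t _; rewrite lee_fin.
by move: nh; rewrite muleC lte_pdivrMr // -?lte_pdivlMr // mulyr gtr0_sg // mul1e.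
Qed.

HB.instance Definition _ := Measure_isSigmaFinite.Build _ _ _ m' msupport_sigma_finite.

Lemma integral_msupport (g : T -> \bar R) : (forall t, h t = 0 -> g t = 0%E) ->
  (\int[m']_t g t = \int[m]_t g t)%E.
Proof.
move=> g0; have gE : g = g \_ (h @^-1` [set~ 0]).
  apply/funext => t; rewrite patchE; case: ifPn => // /negP.
  by rewrite inE /= => /contrapT /g0.
rewrite gE -!integral_mkcond; apply: eq_measure_integral => A mA Ah.
rewrite -[in RHS](setIidl Ah). exact: erefl.
Qed.

End msupport_theory.

Section fubini_msupport.
Context d1 d2 (T1 : measurableType d1) (T2 : measurableType d2) (R : realType).
Variable m1 : {sigma_finite_measure set T1 -> \bar R}.
Variable m2 : {measure set T2 -> \bar R}.
Variables (h : T2 -> R) (mh : measurable_fun setT h) (h_ge0 : forall t, 0 <= h t).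
Hypothesis ih : (\int[m2]_t (h t)%:E < +oo)%E.
Let m2' : {sigma_finite_measure set T2 -> \bar R} := msupport mh h_ge0 ih.

(** [F] is carried by the set D where h(y) <> 0. For A inside D, the product [\x^] integrates over y
    the [m1]-measure of the section of A at y, which is empty when h(y) = 0, so [m2] may be replaced
    by its restriction. Between sigma-finite measures the two orders of integration define the same
    product. *)
Lemma integral_prod_msupport (F : T1 * T2 -> \bar R) :
  (forall z, h z.2 = 0 -> F z = 0%E) ->
  (\int[m1 \x^ m2]_z F z = \int[m1 \x m2']_z F z)%E.
Proof.
move=> F0; pose D := [set: T1] `*` (h @^-1` [set~ 0]).
have FE : F = F \_ D.
  apply/funext => z; rewrite patchE; case: ifPn => // /negP zD.
  by apply: F0; apply: contrapT => hz; apply: zD; rewrite inE.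
rewrite FE -!integral_mkcond; apply: eq_measure_integral => A mA AD.
transitivity ((m1 \x^ m2')%E A); last first.
  by apply/esym/product_measure_unique => // B C mB mC; exact: product_measure2E.
apply/esym/integral_msupport => y hy /=.
rewrite (_ : ysection A y = set0) ?measure0 //.
apply/seteqP; split => // x; rewrite /ysection /= inE => /AD [_] /=.
by rewrite hy.
Qed.

Lemma tonelli_msupport (F : T1 * T2 -> \bar R) : measurable_fun setT F ->
  (forall z, 0 <= F z)%E -> (forall z, h z.2 = 0 -> F z = 0%E) ->
  (\int[m1 \x^ m2]_z F z = \int[m1]_x \int[m2]_y F (x, y))%E.
Proof.
move=> mF F_ge0 F0; rewrite integral_prod_msupport // fubini_tonelli1 //.
by apply: eq_integral => x _; rewrite /fubini_F integral_msupport // => y /(F0 (x, y)).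
Qed.

Section product_function.
Variables (a : T1 -> R) (b : T2 -> R).
Hypotheses (ia : m1.-integrable setT (EFin \o a)).
Hypotheses (ib : m2.-integrable setT (EFin \o b)).
Hypothesis b0 : forall y, h y = 0 -> b y = 0.

Let ab (z : T1 * T2) : \bar R := (a z.1 * b z.2)%:E.

Let mab : measurable_fun setT ab.
Proof.
apply/measurable_EFinP; apply: measurable_funM.
- by apply: measurableT_comp; [exact/measurable_EFinP/(measurable_int m1)|].
- by apply: measurableT_comp; [exact/measurable_EFinP/(measurable_int m2)|].
Qed.

Let ib' : m2'.-integrable setT (EFin \o b).
Proof.
apply/integrableP; split; first exact: (measurable_int m2).
rewrite integral_msupport; first by case/integrableP: ib.
by move=> y /b0 /= ->; rewrite normr0.
Qed.

Let iab' : (m1 \x m2')%E.-integrable setT ab.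
Proof.
apply/integrable12ltyP => //.
under eq_integral => x _.
  under eq_integral do rewrite /ab /= normrM EFinM.
  rewrite ge0_integralZl_EFin //; last first.
    by apply/measurable_EFinP; apply: measurableT_comp => //;
       exact/measurable_EFinP/(measurable_int m2).
  over.
have [_ b_lty] := integrableP _ _ _ ib'; have [_ a_lty] := integrableP _ _ _ ia.
rewrite ge0_integralZr //.
- by rewrite lte_mul_pinfty // ?integral_ge0 // ge0_fin_numE ?integral_ge0.
- by apply/measurable_EFinP; apply: measurableT_comp => //;
     exact/measurable_EFinP/(measurable_int m1).
- by apply: integral_ge0.
Qed.

Lemma integrable_prod : (m1 \x^ m2)%E.-integrable setT ab.
Proof.
apply/integrableP; split => //; rewrite integral_prod_msupport.
  by case/integrableP: iab'.
by move=> z /b0; rewrite /ab => ->; rewrite mulr0 abse0.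
Qed.

(** Fubini's theorem for separated variables: the entries of L(v) pi_x L(v)^* are finite sums of
    such products. *)
Lemma Rintegral_prod : \int[(m1 \x^ m2)%E]_z (a z.1 * b z.2) =
  \int[m1]_x a x * \int[m2]_y b y.
Proof.
rewrite {1}/Rintegral integral_prod_msupport; last first.
  by move=> z /b0 ->; rewrite mulr0.
rewrite -(integral12_prod_meas1 iab').
transitivity (fine (\int[m1]_x ((a x)%:E * (\int[m2]_y b y)%:E))%E).
  congr fine; apply: eq_integral => x _; rewrite /ab /fubini_F /=.
  under eq_integral do rewrite EFinM.
  rewrite integralZl // integral_msupport; last by move=> y /b0 /= ->.
  by rewrite /Rintegral fineK // integrable_fin_num.
by rewrite integralZr // fineM // integrable_fin_num.
Qed.

End product_function.

End fubini_msupport.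

(** * The Markov kernel of the channel *)

Section complex_product.
Context d1 d2 (T1 : measurableType d1) (T2 : measurableType d2) (R : realType).
Variable m1 : {sigma_finite_measure set T1 -> \bar R}.
Variable m2 : {measure set T2 -> \bar R}.
Variables (h : T2 -> R) (mh : measurable_fun setT h) (h_ge0 : forall t, 0 <= h t).
Hypothesis ih : (\int[m2]_t (h t)%:E < +oo)%E.
Variables (a : T1 -> R[i]) (b : T2 -> R[i]).
Hypotheses (ia : cintegrable m1 a) (ib : cintegrable m2 b).
Hypothesis b0 : forall y, h y = 0 -> b y = 0.

Let rb0 y : h y = 0 -> complex.Re (b y) = 0. Proof. by move/b0 ->. Qed.
Let ib0 y : h y = 0 -> complex.Im (b y) = 0. Proof. by move/b0 ->. Qed.

Let irr := integrable_prod mh h_ge0 ih ia.1 ib.1 rb0.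
Let iii := integrable_prod mh h_ge0 ih ia.2 ib.2 ib0.
Let iri := integrable_prod mh h_ge0 ih ia.1 ib.2 ib0.
Let iir := integrable_prod mh h_ge0 ih ia.2 ib.1 rb0.

Lemma cintegrable_prod :
  cintegrable (m1 \x^ m2)%E (fun z => a z.1 * b z.2).
Proof.
split.
- have := integrableB measurableT irr iii; apply: eq_integrable => // z _ /=.
  by case: (a z.1) => ? ?; case: (b z.2).
- have := integrableD measurableT iri iir; apply: eq_integrable => // z _ /=.
  by case: (a z.1) => ? ?; case: (b z.2).
Qed.

Lemma cintegral_prod : cintegral (m1 \x^ m2)%E (fun z => a z.1 * b z.2) =
  cintegral m1 a * cintegral m2 b.
Proof.
rewrite /cintegral; apply/eqP; rewrite eq_complex /=; apply/andP; split; apply/eqP.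
- rewrite -(Rintegral_prod mh h_ge0 ih ia.1 ib.1 rb0).
  rewrite -(Rintegral_prod mh h_ge0 ih ia.2 ib.2 ib0) -RintegralB //.
  by apply: eq_Rintegral => z _; case: (a z.1) => ? ?; case: (b z.2).
- rewrite -(Rintegral_prod mh h_ge0 ih ia.1 ib.2 ib0).
  rewrite -(Rintegral_prod mh h_ge0 ih ia.2 ib.1 rb0) -RintegralD //.
  by apply: eq_Rintegral => z _; case: (a z.1) => ? ?; case: (b z.2).
Qed.

End complex_product.

Section channel_theory.
Variables (R : realType) (k : nat).
Variable mu : {measure set (borelM R k) -> \bar R}.
Variable L : borelM R k -> borelM R k.
Hypothesis mL : measurable_fun setT L.
Hypothesis L2 : square_integrable mu L.
Local Notation "'L_' v" := (L v : 'M[R[i]]_k.+1) (at level 0).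
Local Notation hL := (fun v => hsnorm (L v) ^+ 2).

Lemma measurable_hsnormL : measurable_fun setT hL.
Proof.
have [+ _] : cmeasurable (fun v => \tr (L_ v *m (L_ v) ^t*)).
  apply: cmeasurable_sum => i; apply: mxmeasurable_mulmx; first exact: mxmeasurable_L.
  by apply: mxmeasurable_trmxC; exact: mxmeasurable_L.
by under eq_fun do rewrite -hsnorm_sqr.
Qed.

Lemma hsnormL_ge0 v : 0 <= hL v. Proof. exact: sqr_ge0. Qed.

(** Each entry is bounded by the norm of the matrix, so the product is dominated by [hL]. *)
Lemma cintegrable_LLC i j p q : cintegrable mu (fun v => L_ v i p * (L_ v j q)^*%R).
Proof.
apply: (@le_cintegrable _ _ _ _ _ hL).
- apply: cmeasurableM; first exact: mxmeasurable_L.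
  by apply: cmeasurable_conj; exact: mxmeasurable_L.
- apply/integrableP; split;
    first by apply/measurable_EFinP; refine measurable_hsnormL.
  rewrite (le_lt_trans _ L2) // le_eqVlt; apply/orP; left; apply/eqP.
  apply: eq_integral => v _.
  by rewrite /= ger0_norm ?hsnormL_ge0.
- move=> v; rewrite normrM norm_conjC realcX expr2.
  by apply: ler_pM => //; exact: normr_le_hsnorm.
Qed.

Lemma mulmx_conjE n (A B : 'M[R[i]]_n) i j :
  (A *m B *m A ^t*) i j = \sum_q \sum_p B p q * (A i p * (A j q)^*%R).
Proof.
rewrite mxE; apply: eq_bigr => q _; rewrite mxE mulr_suml; apply: eq_bigr => p _.
by rewrite trmxCE mulrCA mulrA.
Qed.

Lemma mxintegrable_LBL (B : 'M[R[i]]_k.+1) :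
  mxintegrable mu (fun v => L_ v *m B *m (L_ v) ^t*).
Proof.
move=> i j; under [X in cintegrable _ X]eq_fun do rewrite mulmx_conjE.
apply: cintegrable_sum => q; apply: cintegrable_sum => p.
exact/cintegrableZ/cintegrable_LLC.
Qed.

(** Coordinates of the channel, from which its linearity, its effect on traces and the Fubini step
    are read off. *)
Lemma phiE (B : 'M[R[i]]_k.+1) i j : phi mu L B i j =
  \sum_q \sum_p B p q * cintegral mu (fun v => L_ v i p * (L_ v j q)^*%R).
Proof.
rewrite mxE; under eq_fun do rewrite mulmx_conjE.
rewrite cintegral_sum; last first.
  by move=> q; apply: cintegrable_sum => p; exact/cintegrableZ/cintegrable_LLC.
apply: eq_bigr => q _; rewrite cintegral_sum; last first.
  by move=> p; exact/cintegrableZ/cintegrable_LLC.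
by apply: eq_bigr => p _; rewrite cintegralZ //; exact: cintegrable_LLC.
Qed.

Section fixed_nu.
Variable nu : probability (borelP R k) R.

Lemma cintegrable_ppi i j : cintegrable nu (fun x => ppi x i j).
Proof.
apply: (@bounded_cintegrable _ _ _ _ _ 1); first exact: mxmeasurable_ppi.
by move=> x; exact: normr_ppi_le1.
Qed.

Lemma mxintegral_jump : mxintegral (nu \x^ mu)%E
    (fun z : borelP R k * borelM R k =>
      L_ (z.2) *m ppi z.1 *m (L_ (z.2)) ^t*) = phi mu L (barycenter nu).
Proof.
(* This vanishing is the condition for passing to the sigma-finite restriction of [mu]. *)
have L0 i j p q v : hL v = 0 -> L_ v i p * (L_ v j q)^*%R = 0.
  move/eqP; rewrite sqrf_eq0 hsnorm_eq0 => /eqP ->.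
  by rewrite mxE mul0r.
have mh := measurable_hsnormL.
have iF i j p q := cintegrable_prod mh hsnormL_ge0 L2
  (cintegrable_ppi p q) (cintegrable_LLC i j p q) (L0 i j p q).
apply/matrixP => i j; rewrite phiE mxE.
under eq_fun do rewrite mulmx_conjE.
rewrite cintegral_sum; last first.
  by move=> q; apply: cintegrable_sum => p; exact: iF.
apply: eq_bigr => q _; rewrite cintegral_sum; last by move=> p; exact: iF.
apply: eq_bigr => p _.
rewrite (cintegral_prod mh hsnormL_ge0 L2
  (cintegrable_ppi p q) (cintegrable_LLC i j p q) (L0 i j p q)).
by rewrite mxE.
Qed.

Definition jump_law : set (borelP R k * borelM R k) -> \bar R :=
  mdensity (nu \x^ mu)%E (measurable_weight mL) (@weight_ge0 _ _ L).

HB.instance Definition _ := Measure.on jump_law.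

Lemma mxintegral_jump_law :
  mxintegral jump_law (fun z => ppi (jump L z)) = phi mu L (barycenter nu).
Proof.
rewrite -mxintegral_jump; apply/matrixP => i j; rewrite !mxE.
rewrite cintegral_mdensity; last exact: mxmeasurable_ppi_jump.
by congr cintegral; apply/funext => z; rewrite -weight_ppi_jump mx_scaleE.
Qed.

(** Invariance says that S and its preimage under [jump L] have equal mass for [nu] and [jump_law].
    It is applied to the sets S = f^-1(B) with f a real or imaginary part of an entry of [ppi], so
    that two laws on the real line are compared. *)
Lemma barycenter_jump_law : invariant_for_Pi mu L nu ->
  barycenter nu = mxintegral jump_law (fun z => ppi (jump L z)).
Proof.
move=> inv.
have key (f : borelP R k -> R) : measurable_fun setT f ->
    measurable_fun setT (f \o jump L) ->
    \int[nu]_x f x = \int[jump_law]_z f (jump L z).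
  move=> mf mfj; congr fine.
  apply: (eq_integral_image mf mfj _ (g := idfun)); last exact: measurable_id.
  move=> B mB.
  have mA : measurable (f @^-1` B) by rewrite -[X in measurable X]setTI; exact: mf.
  apply: (etrans (esym (inv _ mA))); rewrite /PiL.
  transitivity (\int[nu \x^ mu]_(z in (f \o jump L) @^-1` B) (weight L z)%:E)%E;
    last exact: erefl.
  rewrite [RHS]integral_mkcond.
  apply: eq_integral => z _; rewrite patchE indicE.
  rewrite (_ : (z \in _) = (pact (L z.2) z.1 \in f @^-1` B)).
    by case: ifP; rewrite ?mul1r ?mul0r.
  by apply/idP/idP; rewrite !inE.
apply/matrixP => i j; rewrite !mxE /cintegral.
have [mr mi] := @mxmeasurable_ppi R k i j.
have [mrj mij] := mxmeasurable_ppi_jump mL i j.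
by rewrite (key _ mr mrj) (key _ mi mij).
Qed.

Lemma barycenter_fixed : invariant_for_Pi mu L nu ->
  barycenter nu = phi mu L (barycenter nu).
Proof. by move/barycenter_jump_law => {1}->; exact: mxintegral_jump_law. Qed.

End fixed_nu.
End channel_theory.

(** * The path measure at times 0 and 1 *)

Section path_measure.
Variables (R : realType) (k : nat).
Variable mu : {measure set (borelM R k) -> \bar R}.
Variable L : borelM R k -> borelM R k.
Hypothesis mL : measurable_fun setT L.
Hypothesis L2 : square_integrable mu L.
Variable nu : probability (borelP R k) R.
Variable P : probability (borelP R k * Omega R k)%type R.
Hypothesis PE : is_Pnu mu L nu P.

Lemma path_marginal0 (S : set (borelP R k)) : measurable S ->
  P (fst @^-1` S) = nu S.
Proof.
move=> mS; have -> : fst @^-1` S = S `*` [set: nat -> borelM R k].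
  by apply/seteqP; split => -[x w] //= [].
(* [W 0] is the identity, so the integrand is the squared norm of a unit vector. *)
rewrite (PE (n := 0)) //; last first.
  exact: (@measurableT _ (g_sigma_algebraType (\bigcup_(i in `I_0) @coord_sets R k i))).
rewrite /= -[RHS]mul1e -integral_cst //; apply: eq_integral => x _.
by rewrite indicE in_setT mul1r mul1mx hsnorm_unit_rep expr1n.
Qed.

Lemma mxintegral_X0 : mxintegral P (fun z => ppi (X L 0 z)) = barycenter nu.
Proof.
have -> : (fun z => ppi (X L 0 z)) = (@ppi R k) \o fst.
  by apply/funext => z; rewrite /X /= pact1.
apply/matrixP => i j; rewrite [LHS]mxE [RHS]mxE.
exact: (eq_cintegral_image (m1 := P) measurable_fst (@measurable_id _ _ setT)
  path_marginal0 (g := fun x => ppi x i j) (@mxmeasurable_ppi R k i j)).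
Qed.

(** [X L 1] is [jump L \o tau], so time 1 only requires the law of [tau]. *)
Let tau (z : borelP R k * Omega R k) : borelP R k * borelM R k := (z.1, z.2 0%N).

Let mtau : measurable_fun setT tau.
Proof.
apply: measurable_fun_pair; first exact: measurable_fst.
have m0 : measurable_fun [set: Omega R k] (fun w : Omega R k => w 0%N).
  move=> _ B mB; apply: sub_sigma_algebra; exists 0%N => //.
  by exists B.
exact: (measurableT_comp m0 measurable_snd).
Qed.

(** [is_Pnu] integrates over the matrix inside and the line outside, while [\x^] has the matrix
    outside. Tonelli's theorem closes the gap, since the weight vanishes where L(v) = 0. *)
Lemma path_law1_rectangle (S : set (borelP R k)) (B : set (borelM R k)) :
  measurable S -> measurable B ->
  P (tau @^-1` (S `*` B)) = jump_law mu mL nu (S `*` B).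
Proof.
move=> mS mB; pose O := [set w : nat -> borelM R k | B (w 0%N)].
have -> : tau @^-1` (S `*` B) = S `*` O by [].
rewrite (PE (n := 1)) //; last first.
  apply: sub_sigma_algebra; exists 0%N => //; exists B => //.
  by rewrite setTI.
transitivity (\int[nu \x^ mu]_(z in S `*` B) (weight L z)%:E)%E; last exact: erefl.
have mSB : measurable (S `*` B) by exact: measurableX.
rewrite [RHS]integral_mkcond.
rewrite (tonelli_msupport nu (measurable_hsnormL mL)
  (@hsnormL_ge0 _ _ L) L2); last 3 first.
- apply/measurable_restrict => //; rewrite ?setTI //.
  by apply/measurable_EFinP; apply: measurable_funTS; refine (measurable_weight mL).
- by move=> z; rewrite patchE; case: ifP => // _; rewrite lee_fin weight_ge0.
- move=> z; move/eqP; rewrite sqrf_eq0 hsnorm_eq0 => /eqP Lz.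
  by rewrite patchE; case: ifP => // _; rewrite /weight Lz mul0mx;
    move: (hsnorm_eq0 (0 : 'cV[R[i]]_k.+1)); rewrite eqxx => /eqP ->; rewrite expr0n.
rewrite integral_mkcond; apply: eq_integral => x _; rewrite patchE.
case: ifPn => xS.
  apply: eq_integral => v _; rewrite patchE indicE /= mulmx1.
  rewrite (_ : (_ \in O) = ((x, v) \in S `*` B)).
    by case: ifP; rewrite ?mul1r ?mul0r.
  apply/idP/idP; rewrite !inE; last by case.
  by move=> Bv; split => //; exact: set_mem.
rewrite integral0_eq // => v _; rewrite patchE memNset // => -[/=].
by move/mem_set; rewrite (negPf xS).
Qed.

(** Rectangles are stable under intersection and generate the product sigma-algebra; as P has finite
    mass, the whole space serves as the exhausting sequence. *)
Lemma path_law1 (A : set (borelP R k * borelM R k)) : measurable A ->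
  P (tau @^-1` A) = jump_law mu mL nu A.
Proof.
pose m1 : {measure set (borelP R k * borelM R k) -> \bar R} := pushforward P tau.
pose m2 : {measure set (borelP R k * borelM R k) -> \bar R} := jump_law mu mL nu.
pose G := [set (S `*` B : set (borelP R k * borelM R k)) |
  S in measurable & B in measurable].
have GE : measurable = <<s G >> by exact: measurable_prod_measurableType.
move=> mA; change (m1 mtau A = m2 A).
apply: (@g_sigma_algebra_measure_unique _ _ _ G _ (fun=> setT) _ _ (m1 mtau) m2).
- by move=> _ [S mS [B mB <-]]; exact: measurableX.
- by move=> _; exists setT => //; exists setT => //; rewrite setXTT.
- by apply/seteqP; split => // z _; exists 0%N.
- move=> _ _ [S mS [B mB <-]] [S' mS' [B' mB' <-]].
  by rewrite -setXI; exists (S `&` S'); [exact: measurableI|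
    exists (B `&` B') => //; exact: measurableI].
- by move=> _ [S mS [B mB <-]]; exact: path_law1_rectangle.
- by move=> _; change (P setT < +oo)%E; rewrite probability_setT ltry.
- by rewrite -GE.
Qed.

Lemma mxintegral_X1 :
  mxintegral P (fun z => ppi (X L 1 z)) = phi mu L (barycenter nu).
Proof.
have -> : (fun z => ppi (X L 1 z)) = (fun z => ppi (jump L z)) \o tau.
  by apply/funext => z; rewrite /X /= mulmx1.
rewrite -(mxintegral_jump_law mL L2); apply/matrixP => i j.
rewrite [LHS]mxE [RHS]mxE.
exact: (eq_cintegral_image (m1 := P) mtau (@measurable_id _ _ setT)
  path_law1 (g := fun z => ppi (jump L z) i j) (mxmeasurable_ppi_jump mL i j)).
Qed.

End path_measure.

(** * Fixed points of irreducible channels *)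

Section irreducible_channel.
Variables (R : realType) (k : nat).
Variable mu : {measure set (borelM R k) -> \bar R}.
Variable L : borelM R k -> borelM R k.
Hypothesis mL : measurable_fun setT L.
Hypothesis L2 : square_integrable mu L.
Local Notation C := R[i].
Local Notation M := 'M[C]_k.+1.
Local Notation "'L_' v" := (L v : M) (at level 0).
Local Notation phi := (phi mu L).

Lemma phi_matrixE (B : M) : phi B = \matrix_(i, j) \sum_q \sum_p
  B p q * cintegral mu (fun v => L_ v i p * (L_ v j q)^*%R).
Proof. by apply/matrixP => i j; rewrite [RHS]mxE; exact: phiE. Qed.

Lemma phiB (A B : M) : phi (A - B) = phi A - phi B.
Proof.
rewrite !phi_matrixE; apply/matrixP => i j.
rewrite [RHS]mx_subE [LHS]mxE [X in _ = X - _]mxE [X in _ = _ - X]mxE -sumrB.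
apply: eq_bigr => q _; rewrite -sumrB; apply: eq_bigr => p _.
by rewrite mx_subE mulrBl.
Qed.

Lemma phiZ c (A : M) : phi (c *: A) = c *: phi A.
Proof.
rewrite !phi_matrixE; apply/matrixP => i j.
rewrite [RHS]mx_scaleE [LHS]mxE [X in _ = _ * X]mxE mulr_sumr.
apply: eq_bigr => q _; rewrite mulr_sumr; apply: eq_bigr => p _.
by rewrite mx_scaleE mulrA.
Qed.

Lemma phi_sum (I : finType) (Q : pred I) (F : I -> M) :
  phi (\sum_(i | Q i) F i) = \sum_(i | Q i) phi (F i).
Proof.
apply: (big_morph phi (id1 := 0)) => [A B|]; last first.
  by rewrite -[X in phi X](subrr 0) phiB subrr.
rewrite -[B in LHS]opprK phiB; congr (_ + _).
by rewrite -[- B]sub0r phiB -[X in phi X - _](subrr 0) phiB subrr sub0r opprK.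
Qed.

(** Setting i = j in [phiE] and summing, the coefficient of A p q becomes the (q, p) entry of the
    integral of L^* L, which is the identity. *)
Lemma mxtrace_phi (A : M) : stochastic mu L -> \tr (phi A) = \tr A.
Proof.
move=> stoL.
have LL p q : cintegral mu (fun v => \sum_i L_ v i p * (L_ v i q)^*%R) = (q == p)%:R.
  move/matrixP/(_ q p): stoL; rewrite [X in X = _]mxE [X in _ = X]mxE => <-.
  congr cintegral; apply/funext => v; rewrite mxE; apply: eq_bigr => i _.
  by rewrite trmxCE mulrC.
transitivity (\sum_q \sum_p A p q *
    cintegral mu (fun v => \sum_i L_ v i p * (L_ v i q)^*%R)).
  rewrite phi_matrixE /mxtrace; under eq_bigr do rewrite mxE.
  rewrite exchange_big; apply: eq_bigr => q _; rewrite exchange_big.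
  apply: eq_bigr => p _; rewrite -mulr_sumr cintegral_sum // => i.
  exact: cintegrable_LLC.
apply: eq_bigr => q _; rewrite (bigD1 q) //= LL eqxx mulr1 big1 ?addr0 // => p pq.
by rewrite LL eq_sym (negPf pq) mulr0.
Qed.

(** Positivity of the channel in quantitative form. It is used with E an eigenvector, for signs, and
    with E a projector, for the case of equality. *)
Lemma mxtrace_phi_quad m (A : M) (E : 'M[C]_(k.+1, m)) :
  \tr (A *m phi (E *m E ^t*) *m A ^t*) =
  (\int[mu]_v (hsnorm (A *m L_ v *m E) ^+ 2))%:C.
Proof.
have iL := mxintegrable_LBL mL L2 (E *m E ^t*).
rewrite -mxintegral_mulmx // -cintegral_mxtrace; last exact: mxintegrable_mulmx.
have -> : (fun v => \tr (A *m (L_ v *m (E *m E ^t*) *m (L_ v) ^t*) *m A ^t*)) =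
    (fun v => (hsnorm (A *m L_ v *m E) ^+ 2)%:C).
  by apply/funext => v; rewrite hsnorm_sqr !trmxC_mul !mulmxA.
by rewrite /cintegral /= Rintegral_cst // mul0r.
Qed.

Lemma measurable_hsnorm_quad m (A : M) (E : 'M[C]_(k.+1, m)) :
  measurable_fun setT (fun v : borelM R k => hsnorm (A *m L_ v *m E) ^+ 2).
Proof.
have mF : mxmeasurable (fun v : borelM R k => A *m L_ v *m E).
  apply: mxmeasurable_mulmx; last exact: mxmeasurable_cst.
  apply: mxmeasurable_mulmx; first exact: mxmeasurable_cst.
  exact: mxmeasurable_L.
have [+ _] : cmeasurable (fun v : borelM R k => \tr (A *m L_ v *m E *m (A *m L_ v *m E) ^t*)).
  apply: cmeasurable_sum => i; apply: mxmeasurable_mulmx; first exact: mF.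
  exact: mxmeasurable_trmxC.
by under eq_fun do rewrite -hsnorm_sqr.
Qed.

Lemma mxtrace_phi_quad_eq0 m (A : M) (E : 'M[C]_(k.+1, m)) :
  \tr (A *m phi (E *m E ^t*) *m A ^t*) = 0 ->
  {ae mu, forall v, A *m L_ v *m E = 0}.
Proof.
rewrite mxtrace_phi_quad => /complexI int0.
have mF := measurable_hsnorm_quad A E.
have iL := mxintegrable_LBL mL L2 (E *m E ^t*).
(* Integrability is needed because [fine] also sends an infinite integral to 0. *)
have [iF _] : cintegrable mu (fun v => \tr (A *m (L_ v *m (E *m E ^t*) *m (L_ v) ^t*) *m A ^t*)).
  by apply: cintegrable_sum => i; exact: mxintegrable_mulmx.
have {}iF : mu.-integrable setT (fun v => (hsnorm (A *m L_ v *m E) ^+ 2)%:E).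
  apply: eq_integrable iF => // v _.
  by rewrite -[hsnorm _ ^+ 2]/(complex.Re (hsnorm _ ^+ 2)%:C) hsnorm_sqr !trmxC_mul !mulmxA.
have mF' : measurable_fun setT (fun v => (hsnorm (A *m L_ v *m E) ^+ 2)%:E).
  by apply/measurable_EFinP; refine mF.
have : (\int[mu]_v `|(hsnorm (A *m L_ v *m E) ^+ 2)%:E| = 0)%E.
  under eq_integral do rewrite gee0_abs ?lee_fin ?sqr_ge0 //.
  by rewrite -[LHS]fineK ?integrable_fin_num // [fine _]int0.
move/(ae_eq_integral_abs mu measurableT mF'); apply: filterS => v /(_ I) /=.
by move=> [] /eqP; rewrite sqrf_eq0 hsnorm_eq0 => /eqP.
Qed.

End irreducible_channel.

(** * Spectral decomposition of Hermitian matrices *)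

Lemma hermitian_spectral_sum (C : numClosedFieldType) n (D : 'M[C]_n) :
  D ^t* = D -> exists (d : 'I_n -> C) (e : 'I_n -> 'cV[C]_n),
  [/\ forall i, d i \is Num.real,
      forall i j, (e i) ^t* *m e j = (i == j)%:R%:M
      & D = \sum_i d i *: (e i *m (e i) ^t*)].
Proof.
move=> hD; have Dh : D \is hermsymmx.
  by apply/is_hermitianmxP; rewrite expr0 scale1r hD.
have := hermitian_spectral_diag_real Dh.
have /orthomx_spectralP := hermitian_normalmx Dh.
have := spectral_unitarymx D.
move: (spectralmx D) (spectral_diag D) => U d Uu; rewrite invmx_unitary // => DE dr.
have UU : U *m U ^t* = 1%:M by apply/unitarymxP.
(* In D = U^* diag(d) U the eigenvectors are the adjoints of the rows of U. *)
exists (fun i => d 0 i), (fun i => (row i U) ^t*); split.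
- by move=> i; move/mxOverP: dr; apply.
- move=> i j; rewrite trmxCK; apply/matrixP => a b; rewrite !ord1 [RHS]mxE eqxx mulr1n.
  move/matrixP/(_ i j): UU; rewrite [in X in _ = X]mxE => <-.
  by rewrite !mxE; apply: eq_bigr => l _; rewrite !mxE.
- rewrite {1}DE; apply/matrixP => a b; rewrite summxE [LHS]mxE.
  apply: eq_bigr => i _; rewrite trmxCK mul_mx_diag !mxE big_ord1 !mxE.
  by rewrite mulrAC mulrC.
Qed.

Lemma trmxC_sum (C : numClosedFieldType) m n (I : finType) (p : pred I)
    (F : I -> 'M[C]_(m, n)) :
  (\sum_(i | p i) F i) ^t* = \sum_(i | p i) (F i) ^t*.
Proof.
apply/matrixP => a b; rewrite !mxE !summxE rmorph_sum.
by apply: eq_bigr => i _; rewrite !mxE.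
Qed.

(** * Traceless Hermitian fixed points *)

Section fixed_point.
Variables (R : realType) (k : nat).
Variable mu : {measure set (borelM R k) -> \bar R}.
Variable L : borelM R k -> borelM R k.
Hypothesis mL : measurable_fun setT L.
Hypothesis L2 : square_integrable mu L.
Local Notation C := R[i].
Local Notation M := 'M[C]_k.+1.
Local Notation "'L_' v" := (L v : M) (at level 0).
Local Notation phi := (phi mu L).

(** Almost everywhere L(v) P = P L(v) P, so compression by P leaves the integrand of phi(PAP)
    unchanged. Hence phi(PAP) is its own witness for membership in the corner. *)
Lemma phi_corner (P : M) : P ^t* = P -> P *m P = P ->
  {ae mu, forall v, (1%:M - P) *m L_ v *m P = 0} ->
  phi @` corner P `<=` corner P.
Proof.
move=> hP PP LP _ [_ [A _ <-] <-]; exists (phi (P *m A *m P)) => //.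
rewrite /Defs.phi -mxintegral_mulmx; last exact: mxintegrable_LBL.
have mF : mxmeasurable (fun v : borelM R k => L_ v *m (P *m A *m P) *m (L_ v) ^t*).
  move=> i j; apply: (@cintegrable_measurable _ _ _ mu); exact: mxintegrable_LBL.
apply/matrixP => i j; rewrite [LHS]mxE [RHS]mxE; apply: ae_eq_cintegral.
- apply: mxmeasurable_mulmx; last exact: mxmeasurable_cst.
  by apply: mxmeasurable_mulmx; first exact: mxmeasurable_cst.
- exact: mF.
apply: filterS LP => v LPv _; apply: (congr1 (fun B : M => B i j)).
have {}LPv : P *m (L_ v *m P) = L_ v *m P.
  by apply/esym/eqP; rewrite -subr_eq0 -[X in X - _]mul1mx -mulmxBl mulmxA LPv.
have LPC : P *m (L_ v) ^t* *m P = P *m (L_ v) ^t*.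
  by have := congr1 (fun B : M => B ^t*) LPv; rewrite !trmxC_mul hP.
transitivity (P *m (L_ v *m P) *m A *m (P *m (L_ v) ^t* *m P)).
  by rewrite !mulmxA.
by rewrite LPv LPC !mulmxA.
Qed.

(** For the eigenprojectors Q_i of D, the trace 1 of phi(Q_i) splits into a_i >= 0 inside P and b_i
    >= 0 outside. As phi fixes D, the d_i b_i add up to the trace of D outside P, the sum of the
    nonpositive d_i. Since b_i <= 1, the nonpositive d_i alone already contribute at least that sum,
    so the positive ones contribute nothing and their b_i are 0. *)
Lemma fixed_traceless_eq0 (D : M) : stochastic mu L -> irreducible mu L ->
  D ^t* = D -> \tr D = 0 -> phi D = D -> D = 0.
Proof.
move=> stoL irrL hD trD phiD.
have [d [e [dr ee DE]]] := hermitian_spectral_sum hD.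
pose Q i := e i *m (e i) ^t*; pose P := \sum_(i | 0 < d i) Q i.
have Qh i : (Q i) ^t* = Q i by rewrite /Q trmxC_mul trmxCK.
have QQ i j : Q i *m Q j = if i == j then Q i else 0.
  rewrite /Q mulmxA -(mulmxA (e i)) ee; case: eqP => [->|_].
    by rewrite mulmx1.
  by rewrite mul_mx_scalar scale0r mul0mx.
have trQ i : \tr (Q i) = 1.
  by rewrite /Q mxtrace_mulC ee eqxx mxtrace1.
have PQ i : P *m Q i = if 0 < d i then Q i else 0.
  rewrite /P mulmx_suml; case: ifPn => di.
    rewrite (bigD1 i) //= QQ eqxx big1 ?addr0 // => j /andP[_ ji].
    by rewrite QQ (negPf ji).
  by rewrite big1 // => j dj; rewrite QQ; case: eqP dj di => [-> ->|].
have hP : P ^t* = P.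
  by rewrite /P trmxC_sum; apply: eq_bigr => i _; exact: Qh.
have PP : P *m P = P.
  by rewrite {2}/P mulmx_sumr; apply: eq_bigr => i di; rewrite PQ di.
have hP' : (1%:M - P) ^t* = 1%:M - P.
  by rewrite trmxC_sub hP trmx1 map_mx1.
have PP' : (1%:M - P) *m (1%:M - P) = 1%:M - P.
  by rewrite mulmxBl mul1mx mulmxBr mulmx1 PP subrr subr0.
have trS (B X : M) : B ^t* = B -> B *m B = B -> \tr (B *m X *m B ^t*) = \tr (B *m X).
  by move=> hB BB; rewrite hB mxtrace_mulC mulmxA BB.
have trD' : \sum_i d i = 0.
  rewrite -[RHS]trD [in RHS]DE (raddf_sum (@mxtrace C k.+1)) /=; apply: eq_bigr => i _.
  by rewrite mxtraceZ trQ mulr1.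
pose a i := \tr (P *m phi (Q i)); pose b i := \tr ((1%:M - P) *m phi (Q i)).
have a_ge0 i : 0 <= a i.
  rewrite /a -trS // mxtrace_phi_quad // ler0c; apply: Rintegral_ge0 => v _.
  exact: sqr_ge0.
have b_ge0 i : 0 <= b i.
  rewrite /b -trS // mxtrace_phi_quad // ler0c; apply: Rintegral_ge0 => v _.
  exact: sqr_ge0.
have phiDE : \sum_i d i *: phi (Q i) = D.
  by rewrite -[RHS]phiD [in RHS]DE phi_sum //; apply: eq_bigr => i _; rewrite phiZ.
have db0 : \sum_i d i * b i = \sum_(i | ~~ (0 < d i)) d i.
  transitivity (\tr ((1%:M - P) *m D)).
    rewrite -[D in RHS]phiDE mulmx_sumr (raddf_sum (@mxtrace C k.+1)) /=.
    apply: eq_bigr => i _.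
    by rewrite -scalemxAr mxtraceZ.
  rewrite [in LHS]DE mulmx_sumr (raddf_sum (@mxtrace C k.+1)) /= [RHS]big_mkcond /=.
  apply: eq_bigr => i _; rewrite -scalemxAr mxtraceZ mulmxBl mul1mx PQ.
  by case: ifP => _; rewrite ?subrr ?subr0 ?mxtrace0 ?trQ ?mulr0 ?mulr1.
have ab1 i : a i + b i = 1.
  by rewrite /a /b -mxtraceD -mulmxDl addrC subrK mul1mx mxtrace_phi // trQ.
(* The order of [R[i]] is partial; the eigenvalues are comparable with 0 because they are real. *)
have dN i : ~~ (0 < d i) -> d i <= 0.
  by rewrite real_ltNge ?real0 // negbK.
have sum0 : \sum_(i | 0 < d i) d i * b i = 0.
  apply/eqP; rewrite eq_le sumr_ge0 ?andbT; last first.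
    by move=> i di; rewrite mulr_ge0 // ltW.
  have -> : \sum_(i | 0 < d i) d i * b i =
      \sum_(i | ~~ (0 < d i)) d i - \sum_(i | ~~ (0 < d i)) d i * b i.
    by rewrite -db0 [in RHS](bigID (fun i => 0 < d i)) /= addrK.
  rewrite -sumrB; apply: sumr_le0 => i di.
  rewrite -[X in X - _]mulr1 -mulrBr -(ab1 i) addrK.
  by rewrite mulr_le0_ge0 // dN.
(* This trace is the sum of the b_i over the positive eigenvalues. *)
have bP : \tr ((1%:M - P) *m phi (P *m P ^t*) *m (1%:M - P) ^t*) = 0.
  rewrite trS // hP PP /P phi_sum // mulmx_sumr (raddf_sum (@mxtrace C k.+1)) /=.
  apply: big1 => i di; have db_ge0 l : 0 < d l -> 0 <= d l * b l.
    by move=> dl; rewrite mulr_ge0 // ltW.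
  have /eqP := psumr_eq0P db_ge0 sum0 di.
  by rewrite mulf_eq0 gt_eqF //= => /eqP.
have LP := mxtrace_phi_quad_eq0 mL L2 bP.
case: (irrL P hP PP (phi_corner hP PP LP)) => P01.
- have dle i : d i <= 0.
    apply: dN; apply/negP => di; have := PQ i; rewrite P01 mul0mx di => Q0.
    by have := trQ i; rewrite -Q0 mxtrace0 => /esym/eqP; rewrite oner_eq0.
  have d0 i : d i = 0.
    apply/eqP; rewrite -oppr_eq0; apply/eqP.
    apply: (psumr_eq0P (P := predT) (F := fun i => - d i)) => //.
      by move=> l _; rewrite oppr_ge0.
    by rewrite sumrN trD' oppr0.
  by rewrite DE big1 // => i _; rewrite d0 scale0r.
- have dgt i : 0 < d i.
    apply/negPn/negP => di; have := PQ i; rewrite P01 mul1mx (negPf di) => Q0.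
    by have := trQ i; rewrite Q0 mxtrace0 => /esym/eqP; rewrite oner_eq0.
  (* The size is a successor, so some eigenvalue exists to contradict the zero trace. *)
  have := psumr_eq0P (P := predT) (fun i _ => ltW (dgt i)) trD' (i := ord0) isT.
  by move=> d0; have := dgt ord0; rewrite d0 ltxx.
Qed.

End fixed_point.

(** * Barycenters as density matrices, and the theorem *)

Section barycenter_theory.
Variables (R : realType) (k : nat) (nu : probability (borelP R k) R).

Lemma barycenter_herm : (barycenter nu) ^t* = barycenter nu.
Proof.
apply/matrixP => i j; rewrite trmxCE [X in X^*%R]mxE [RHS]mxE.
rewrite -cintegral_conj; last exact: cintegrable_ppi.
have ppiC x : (ppi x j i)^*%R = ppi x i j by rewrite -trmxCE ppi_herm.
by under eq_fun do rewrite ppiC.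
Qed.

Lemma mxtrace_barycenter : \tr (barycenter nu) = 1.
Proof.
rewrite /barycenter -cintegral_mxtrace; last by move=> i j; exact: cintegrable_ppi.
rewrite /cintegral; under eq_Rintegral do rewrite mxtrace_ppi.
under [X in _ +i* X]eq_Rintegral do rewrite mxtrace_ppi.
rewrite !Rintegral_cst // mul0r.
transitivity ((1 * fine (1%E : \bar R)) +i* 0); last by rewrite mulr1.
by congr (_ * fine _ +i* _); exact: probability_setT.
Qed.

End barycenter_theory.

Theorem proposition6p2 (R : realType) (k : nat)
  (mu : {measure set (borelM R k) -> \bar R})
  (L : borelM R k -> borelM R k)
  (mL : measurable_fun [set: borelM R k] L)
  (L2 : square_integrable mu L)
  (stoL : stochastic mu L) :
  (forall nu : probability (borelP R k) R, invariant_for_Pi mu L nu ->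
     barycenter nu = phi mu L (barycenter nu) /\
     forall Pnu : probability (borelP R k * Omega R k)%type R,
       is_Pnu mu L nu Pnu ->
       [/\ barycenter nu = mxintegral Pnu (fun z => ppi (X L 0 z)),
           mxintegral Pnu (fun z => ppi (X L 0 z)) =
             mxintegral Pnu (fun z => ppi (X L 1 z)) &
           mxintegral Pnu (fun z => ppi (X L 1 z)) =
             phi mu L (barycenter nu)]) /\
  (irreducible mu L ->
     forall nu nu' : probability (borelP R k) R,
       invariant_for_Pi mu L nu -> invariant_for_Pi mu L nu' ->
       barycenter nu = barycenter nu').
Proof.
split=> [nu inv|irrL nu nu' inv inv'].
  have fix_nu := barycenter_fixed mL L2 inv; split; first exact: fix_nu.
  move=> P PE; have X0 := mxintegral_X0 PE; have X1 := mxintegral_X1 mL L2 PE.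
  split; [exact: esym X0|exact: etrans X0 (etrans fix_nu (esym X1))|exact: X1].
apply/eqP; rewrite -subr_eq0; apply/eqP.
apply: (fixed_traceless_eq0 mL L2 stoL irrL).
- by rewrite trmxC_sub !barycenter_herm.
- by rewrite (raddfB (@mxtrace _ _)) /= !mxtrace_barycenter subrr.
- by rewrite phiB // -!barycenter_fixed.
Qed.
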